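(* Let $K$ be an algebraically closed field of characteristic $0$ and let $d,n$ be integers with $1<d<n$ and $\gcd(n,d)=1$. Let $e$ be a positive integer such that $ed^2-(e+1)d<n$. Then $n+ed$ is $(n,d)$-reachable over $K$.
   Context: For a polynomial $f(x)\in K[x]$ of degree $n$ without repeated roots, $\mathcal{C}_{f,d}$ denotes the smooth projective model of the affine curve $y^d=f(x)$; it has a unique point at infinity $O$. $\mathcal{C}_{f,d}$ is identified with its image in its Jacobian $J(\mathcal{C}_{f,d})$ via $Q\mapsto \operatorname{cl}((Q)-(O))$ (linear equivalence class), and a point $Q\in\mathcal{C}_{f,d}(K)$ has order $m$ if $\operatorname{cl}((Q)-(O))$ has order $m$ in $J(\mathcal{C}_{f,d})(K)$. An integer $m>1$ is called $(n,d)$-reachable over $K$ if there exists a monic polynomial $f(x)\in K[x]$ of degree $n$ without repeated roots such that $\mathcal{C}_{f,d}(K)$ contains a point of order $m$. *)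

(* Defs.v *)
From mathcomp Require Import all_boot all_order all_algebra.
Set Implicit Arguments. Unset Strict Implicit. Unset Printing Implicit Defensive.
Import Order.TTheory GRing.Theory Num.Theory.
Local Open Scope ring_scope.

(* Curve C_{f,d}: y^d = f(x).  Its smooth projective model is described
   birationally through its function field K(C).  A "model" of the function
   field is a field L with an embedding iota : K -> L and elements X, Y with
   Y^d = f(X), X transcendental over K, and L = K(X, Y). *)

Definition ev2 (K L : fieldType) (iota : {rmorphism K -> L}) (X Y : L)
  (p : {poly {poly K}}) : L :=
  (map_poly (fun c : {poly K} => (map_poly iota c).[X]) p).[Y].

Definition is_function_field_model (K L : fieldType) (d : nat) (f : {poly K})
  (iota : {rmorphism K -> L}) (X Y : L) : Prop :=
  [/\ Y ^+ d = (map_poly iota f).[X],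
      (forall p : {poly K}, p != 0 -> (map_poly iota p).[X] != 0) &
      (forall z : L, exists p q : {poly {poly K}},
          ev2 iota X Y q != 0 /\ z = ev2 iota X Y p / ev2 iota X Y q)].

(* Places of L/K = normalized discrete valuations of L trivial on K
   (values on 0 are irrelevant).  They correspond bijectively to the points
   of the smooth projective model of the curve. *)
Definition is_place (K L : fieldType) (iota : {rmorphism K -> L})
  (v : L -> int) : Prop :=
  [/\ (forall a b : L, a != 0 -> b != 0 -> v (a * b) = v a + v b),
      (forall a b : L, a != 0 -> b != 0 -> a + b != 0 ->
          Num.min (v a) (v b) <= v (a + b)),
      (forall c : K, c != 0 -> v (iota c) = 0) &
      (exists t : L, t != 0 /\ v t = 1)].

(* The place of the affine point Q = (a,b): centered at Q.
   The place of O: the (unique) place where x has a pole. *)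
Definition place_at (K L : fieldType) (iota : {rmorphism K -> L}) (X Y : L)
  (a b : K) (v : L -> int) : bool :=
  (0 < v (X - iota a)) && (0 < v (Y - iota b)).

Definition place_at_infinity (L : fieldType) (X : L) (v : L -> int) : bool :=
  v X < 0.

Definition multiple_principal (K L : fieldType) (iota : {rmorphism K -> L})
  (X Y : L) (a b : K) (k : nat) : Prop :=
  exists g : L, g != 0 /\
    forall v : L -> int, is_place iota v ->
      v g = (if place_at iota X Y a b v then k%:Z else 0)
            - (if place_at_infinity X v then k%:Z else 0).

(* cl((Q)-(O)) has order m in the Jacobian. *)
Definition order_in_model (K L : fieldType) (iota : {rmorphism K -> L})
  (X Y : L) (a b : K) (m : nat) : Prop :=
  [/\ (0 < m)%N, multiple_principal iota X Y a b m &
      forall k : nat, (0 < k < m)%N -> ~ multiple_principal iota X Y a b k].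

(* The affine point (a,b) of C_{f,d} has order m (computed in the function
   field, which is unique up to K-isomorphism; we require it for every model). *)
Definition point_has_order (K : fieldType) (d : nat) (f : {poly K})
  (a b : K) (m : nat) : Prop :=
  forall (L : fieldType) (iota : {rmorphism K -> L}) (X Y : L),
    is_function_field_model d f iota X Y -> order_in_model iota X Y a b m.

Definition no_repeated_roots (K : fieldType) (f : {poly K}) : Prop :=
  forall c : K, ~~ ((('X - c%:P) ^+ 2) %| f).

(* m is (n,d)-reachable over K.  Since m > 1 and O has order 1, a point of
   order m is necessarily an affine point (a,b) with b^d = f(a). *)
Definition reachable (K : fieldType) (n d m : nat) : Prop :=
  (1 < m)%N /\
  exists f : {poly K},
    [/\ f \is monic, size f = n.+1, no_repeated_roots f &
        exists a b : K, b ^+ d = f.[a] /\ point_has_order d f a b m].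

(* Main.v *)
Require Import Defs.
From HB Require Import structures.
From mathcomp Require Import all_boot all_order all_algebra all_field.
From mathcomp Require Import boolp.
From mathcomp Require Import zify ring.
Set Implicit Arguments. Unset Strict Implicit. Unset Printing Implicit Defensive.
Import Order.TTheory GRing.Theory Num.Theory.
Local Open Scope ring_scope.

(** Put N = ed, m = n + N, and let u be the truncation in degree < N of
    (1 + t)^(m/d).  The hypothesis on e says d (N - 1) < m, so (1 + t)^m - u^d is
    monic of degree m.  The differential equation
    m u - d (1 + t) u' = C t^(N-1) shows that it equals t^N f with f squarefree
    and f(0) <> 0, u(-1) <> 0.  With U^d = - u^d, the function
    G = y t^e - U on y^d = f(t) divides (y t^e)^d - U^d = (1 + t)^m; it vanishes
    only at one point Q above t = -1 and has pole order m at infinity, so its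
    divisor is m(Q) - m(O).

    If k(Q) - k(O) is principal with k < m, one may take k | m, and then k < n.
    A function with that divisor is regular on the affine curve, hence of the
    form sum_(i < d) p_i(t) y^i; a pole of order k < n forces it to be p_0(t) with
    d deg p_0 = k, which cannot vanish to order k at Q.

    These computations evaluate divisors at places of the function field.  The
    places come from the parametrisations t = a + s, t = a + s^d, t = s^(-d) in
    Laurent series, where y is a d-th root obtained by Newton iteration. *)

(** * The truncated binomial series, its remainder, and the curve obtained from it *)

Lemma exists_root (K : closedFieldType) (d : nat) (v : K) :
  (0 < d)%N -> exists c, c ^+ d = v.
Proof.
move=> d0.
have [x xP] := @solve_monicpoly K d (fun i => if i == 0%N then v else 0) d0.
exists x; rewrite xP (bigD1 (Ordinal d0)) //= expr0 mulr1 big1 ?addr0 //.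
by move=> i; case: i => [[|i]] //= lti _; rewrite mul0r.
Qed.

(* The coefficient of t^k in (1 + t)^(m/d). *)
Definition root_coef (F : fieldType) (m d k : nat) : F :=
  \prod_(j < k) ((m%:R - (d * j)%:R) / (d * j.+1)%:R).

Lemma root_coefS (F : fieldType) m d k : [pchar F] =i pred0 -> (0 < d)%N ->
  (d * k.+1)%:R * root_coef F m d k.+1 = (m%:R - (d * k)%:R) * root_coef F m d k.
Proof.
move=> /pcharf0P F0 d0; rewrite /root_coef big_ord_recr /= mulrCA mulrC.
by congr (_ * _); rewrite mulrC divfK // F0; lia.
Qed.

(** Since d does not divide m, none of the integers m - d j is zero, and characteristic 0 keeps them
    nonzero in F. *)
Lemma root_coef_neq0 (F : fieldType) m d k : [pchar F] =i pred0 -> (0 < d)%N ->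
  ~~ (d %| m)%N -> root_coef F m d k != 0.
Proof.
move=> /pcharf0P F0 d0 ndm; elim: k => [|k IHk]; first by rewrite /root_coef big_ord0 oner_neq0.
have mdk j : m%:R - (d * j)%:R != 0 :> F.
  have [le|lt] := leqP (d * j) m.
    rewrite -natrB // F0 subn_eq0 -ltnNge ltn_neqAle le andbT.
    by apply: contra ndm => /eqP <-; apply: dvdn_mulr.
  by rewrite -opprB oppr_eq0 -natrB ?(ltnW lt) // F0 subn_eq0 -ltnNge.
by rewrite /root_coef big_ord_recr mulf_neq0 // mulf_neq0 ?invr_eq0 ?mdk // F0; lia.
Qed.

Definition root_trunc (F : fieldType) (m d N : nat) : {poly F} :=
  \poly_(k < N) root_coef F m d k.

(** The full series satisfies m u = d (1 + t) u'. In degrees below N the truncation inherits this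
    through [root_coefS]; in degree N the missing coefficient of index N + 1 leaves the single term
    on the right. *)
Lemma root_trunc_ode (F : fieldType) m d N : [pchar F] =i pred0 -> (0 < d)%N ->
  m%:R *: root_trunc F m d N.+1 - d%:R *: (('X + 1) * (root_trunc F m d N.+1)^`())
  = ((m%:R - (d * N)%:R) * root_coef F m d N) *: 'X^N.
Proof.
move=> F0 d0; apply/polyP=> k.
have H i : (root_trunc F m d N.+1)`_i = if (i < N.+1)%N then root_coef F m d i else 0.
  by rewrite coef_poly.
have E : (('X + 1) * (root_trunc F m d N.+1)^`())`_k =
  k%:R * (root_trunc F m d N.+1)`_k + k.+1%:R * (root_trunc F m d N.+1)`_k.+1.
  rewrite mulrDl mul1r coefD coefXM !coef_deriv !(mulr_natl (_`__)).
  by case: k => [|k] //=.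
rewrite coefB !coefZ E coefXn !H !ltnS.
have [lt|gt|->] := ltngtP k N.
- rewrite mulr0 mulrDr [d%:R * (k.+1%:R * _)]mulrA -natrM root_coefS // natrM; ring.
- by rewrite !(mulr0, subr0, addr0).
- by rewrite !(mulr0, mulr1, addr0) natrM; ring.
Qed.

Lemma root_trunc0 (F : fieldType) m d N : (root_trunc F m d N.+1).[0] = 1.
Proof. by rewrite horner_coef0 coef_poly /= /root_coef big_ord0. Qed.

Lemma size_root_trunc_exp (F : fieldType) m d N :
  (d * N < m)%N -> (size (root_trunc F m d N.+1 ^+ d) <= m)%N.
Proof.
move=> lt; apply: leq_trans (size_poly_exp_leq _ _) _.
have : ((size (root_trunc F m d N.+1)).-1 <= N)%N.
  by have := size_poly N.+1 (root_coef F m d); rewrite /root_trunc; lia.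
by move=> H; apply: leq_trans lt; rewrite ltnS mulnC leq_mul.
Qed.

Lemma size_X1n (F : fieldType) m : size (('X + 1 : {poly F}) ^+ m) = m.+1.
Proof. by rewrite -[1]opprK -polyCN size_exp_XsubC. Qed.

Section Remainder.
Variables (F : fieldType) (m d N : nat).
Hypotheses (F0 : [pchar F] =i pred0) (d1 : (1 < d)%N) (ndm : ~~ (d %| m)%N)
  (lt : (d * N < m)%N).
(** Here [N] is the degree of the last term kept, so it stands for ed - 1, whereas the overview
    writes N for ed. *)
Let u := root_trunc F m d N.+1.
Let P : {poly F} := ('X + 1) ^+ m - u ^+ d.
Let C : F := (m%:R - (d * N)%:R) * root_coef F m d N.

Let C0 : C != 0.
Proof.
rewrite mulf_neq0 ?root_coef_neq0 ?(ltnW d1) // -natrB ?(ltnW lt) //.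
by move/pcharf0P: F0 => ->; rewrite subn_eq0 -ltnNge.
Qed.

(** The operator (1 + t) D - m kills (1 + t)^m and sends -u^d to u^(d-1) (m u - d (1 + t) u'), to
    which [root_trunc_ode] applies. *)
Lemma remainder_ode : ('X + 1) * P^`() - m%:R *: P = C *: (u ^+ d.-1 * 'X^N).
Proof.
have -> : C *: (u ^+ d.-1 * 'X^N) = u ^+ d.-1 * (C *: 'X^N) by rewrite scalerAr.
rewrite -root_trunc_ode ?(ltnW d1) // -/u /P derivB !deriv_exp derivD derivX.
have -> : (1 : {poly F})^`() = 0 by rewrite -polyC1 derivC.
rewrite -!mul_polyC -!(mulr_natl (_ * _)) !polyC_natr.
have -> : ('X + 1 : {poly F}) ^+ m = ('X + 1) * ('X + 1) ^+ m.-1.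
  by rewrite -exprS prednK // (leq_ltn_trans _ lt).
have -> : u ^+ d = u * u ^+ d.-1 by rewrite -exprS prednK // ltnW.
ring.
Qed.

(** Write P = t^k p with p(0) nonzero. The left side of [remainder_ode] vanishes at 0 to order
    exactly k - 1 and the right side to order exactly N, because u(0) = 1; hence k = N + 1. *)
Lemma remainder_factor : exists2 f : {poly F}, P = 'X^(N.+1) * f & f.[0] != 0.
Proof.
have u0 : u.[0] = 1 by rewrite root_trunc0.
have Pn0 : P != 0.
  rewrite -size_poly_eq0 size_polyDl ?size_X1n //.
  by rewrite size_polyN ltnS size_root_trunc_exp.
have P0 : P.[0] = 0 by rewrite /P hornerD hornerN !horner_exp u0 hornerD hornerX -polyC1 hornerC add0r !expr1n subrr.
have [k [p]] := multiplicity_XsubC P 0; rewrite Pn0 /= subr0 => np Pk.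
have p0 : p.[0] != 0 by [].
have k0 : (0 < k)%N.
  rewrite lt0n; apply: contra np => /eqP k0; move: Pk; rewrite k0 expr0 mulr1 => <-.
  by rewrite /root P0.
(* [B] is the left side of [remainder_ode] divided by t^(k-1); its value at 0 is k p(0), nonzero in
   characteristic 0. *)
pose B := ('X + 1) * (k%:R *: p + 'X * p^`()) - m%:R *: ('X * p).
have B0 : B.[0] != 0.
  rewrite !hornerE /= !(mul0r, mulr0, addr0, subr0, add0r, mul1r) mulf_neq0 //.
  by move/pcharf0P: F0 => ->; rewrite -lt0n.
have E : 'X^(k.-1) * B = C *: (u ^+ d.-1 * 'X^N).
  rewrite -remainder_ode Pk derivM derivXn /B -!mul_polyC -(mulr_natl _ k) !polyC_natr.
  have -> : 'X^k = 'X * 'X^(k.-1) :> {poly F} by rewrite -exprS prednK.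
  by ring.
have [lt1|gt1|eqk] := ltngtP k N.+1; last first.
- by exists p => //; rewrite Pk eqk mulrC.
- have : (C *: u ^+ d.-1 - 'X^(k.-1 - N) * B).[0] = 0.
    apply/eqP; rewrite -[X in X == 0]/(_.[0]); apply/eqP.
    have : 'X^N * (C *: u ^+ d.-1 - 'X^(k.-1 - N) * B) = 0.
      rewrite mulrBr mulrA -exprD subnKC ?E; last by lia.
      by rewrite -!mul_polyC; ring.
    move/eqP; rewrite mulf_eq0 expf_eq0 polyX_eq0 andbF /= => /eqP ->.
    by rewrite horner0.
  rewrite !hornerE /= u0 expr1n mulr1 expr0n.
  have -> : (k.-1 - N == 0)%N = false by lia.
  by rewrite mul0r subr0 => /eqP; rewrite (negPf C0).
- have : (B - 'X^(N - k.-1) * (C *: u ^+ d.-1)).[0] = 0.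
    have : 'X^(k.-1) * (B - 'X^(N - k.-1) * (C *: u ^+ d.-1)) = 0.
      rewrite mulrBr mulrA -exprD subnKC ?E; last by lia.
      by rewrite -!mul_polyC; ring.
    move/eqP; rewrite mulf_eq0 expf_eq0 polyX_eq0 andbF /= => /eqP ->.
    by rewrite horner0.
  rewrite hornerD hornerN hornerM hornerXn expr0n.
  have -> : (N - k.-1 == 0)%N = false by lia.
  by rewrite mul0r subr0 => /eqP; rewrite (negPf B0).
Qed.

(** At t = -1 the derivative term of [root_trunc_ode] disappears, leaving m u(-1) = C (-1)^N. *)
Lemma root_trunc_N1 : u.[-1] != 0.
Proof.
have m0 : (m%:R : F) != 0.
  by move/pcharf0P: F0 => ->; rewrite -lt0n (leq_ltn_trans _ lt).
have := congr1 (fun p => p.[-1]) (@root_trunc_ode F m d N F0 (ltnW d1)).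
rewrite -/u -/C hornerD hornerN !hornerZ hornerM hornerD hornerX -polyC1 hornerC addNr mul0r mulr0 subr0 hornerXn => E.
apply/eqP => u0; move: E; rewrite u0 mulr0 => /esym/eqP.
by rewrite mulf_eq0 (negPf C0) expf_eq0 oppr_eq0 oner_eq0 andbF.
Qed.

(** A double root c of f is a double root of P, so [remainder_ode] gives u(c)^(d-1) c^N = 0. As f(0)
    is nonzero, c is not 0, hence u(c) = 0; then P(c) = 0 forces c = -1, against [root_trunc_N1]. *)
Lemma remainder_squarefree (f : {poly F}) : P = 'X^(N.+1) * f -> f.[0] != 0 ->
  no_repeated_roots f.
Proof.
move=> Pf f0 c; apply/negP => /dvdpP [q fq].
have Pc : P = ('X^(N.+1) * q) * ('X - c%:P) ^+ 2 by rewrite Pf fq mulrA.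
have P0 : P.[c] = 0 by rewrite Pc hornerM horner_exp hornerXsubC subrr expr0n mulr0.
have P'0 : P^`().[c] = 0.
  rewrite Pc derivM deriv_exp derivXsubC mul1r expr1 hornerD !hornerM hornerMn !hornerXsubC subrr.
  by rewrite !(mul0r, mulr0, addr0, mulr0n, mul0rn).
have := congr1 (fun p => p.[c]) remainder_ode.
rewrite hornerD hornerN hornerM hornerZ P'0 P0 !mulr0 subr0 hornerZ hornerM hornerXn horner_exp.
move/esym/eqP; rewrite mulf_eq0 (negPf C0) mulf_eq0 !expf_eq0 /=.
have [c0|_] := eqVneq c 0.
  by move: f0; rewrite fq hornerM horner_exp hornerXsubC c0 subrr expr0n mulr0 eqxx.
rewrite andbF orbF => /andP[_ /eqP uc].
move: P0; rewrite /P hornerD hornerN !horner_exp uc expr0n -[d == 0%N]negbK -lt0n (ltnW d1) subr0.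
move/eqP; rewrite expf_eq0 => /andP[_]; rewrite !hornerE /= addr_eq0 => /eqP cN1.
by have := root_trunc_N1; rewrite -cN1 uc eqxx.
Qed.

End Remainder.

Lemma exists_curve (K : closedFieldType) (d n e : nat) :
  [pchar K] =i pred0 -> (1 < d)%N -> coprime n d -> (0 < e)%N ->
  (d * (e * d).-1 < n + e * d)%N ->
  exists (f U : {poly K}) (b : K),
  [/\ f \is monic, size f = n.+1, no_repeated_roots f &
   [/\ b != 0, b ^+ d = f.[-1], b * (-1) ^+ e = U.[-1],
     (d * (size U).-1 < n + e * d)%N &
     ('X + 1) ^+ (n + e * d) = 'X^e ^+ d * f - U ^+ d]].
Proof.
move=> K0 d1 cop e0; set m := (n + e * d)%N; set N := (e * d).-1 => lt.
have NS : N.+1 = (e * d)%N by rewrite prednK // muln_gt0 e0 ltnW.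
have ndm : ~~ (d %| m)%N.
  rewrite /m dvdn_addl ?dvdn_mull //; apply/negP => dn.
  by move: cop; rewrite /coprime (gcdn_idPr dn) => /eqP dd; rewrite dd in d1.
pose u := root_trunc K m d N.+1.
have [f Pf f0] := @remainder_factor K m d N K0 d1 ndm lt.
have nrr := @remainder_squarefree K m d N K0 d1 ndm lt f Pf f0.
have fn0 : f != 0 by apply: contra_neq f0 => ->; rewrite horner0.
have szlt : (size (- (u ^+ d)) < size (('X + 1 : {poly K}) ^+ m))%N.
  by rewrite size_X1n size_polyN ltnS size_root_trunc_exp.
have szP : size ('X^(N.+1) * f) = m.+1 by rewrite -Pf size_polyDl // size_X1n.
have mP : 'X^(N.+1) * f \is monic.
  rewrite -Pf monicE lead_coefDl // -monicE -[1]opprK -polyCN.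
  by rewrite monic_exp // monicXsubC.
have [eta etaP] := exists_root (-1 : K) (ltnW d1).
have eta0 : eta != 0.
  apply: contra_eq_neq etaP => ->; rewrite expr0n -[d == 0%N]negbK -lt0n (ltnW d1).
  by rewrite eq_sym oppr_eq0 oner_eq0.
have u1 : u.[-1] != 0 by apply: root_trunc_N1.
have sg : (-1 : K) ^+ e * (-1) ^+ e = 1 by rewrite -exprMn mulrNN mulr1 expr1n.
(* With eta^d = -1 and U = eta u one has U^d = -u^d. The factor (-1)^e in b makes y t^e - U vanish
   at (-1, b); the equation b^d = f(-1) comes from the factorisation evaluated at -1. *)
exists f, (eta *: u), (eta * u.[-1] * (-1) ^+ e); split => //.
- by move: mP; rewrite monicMl // monicXn.
- move: szP NS; rewrite size_monicM ?monicXn // size_polyXn /m; move: (e * d)%N => q.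
  by move=> szP NS; move: szP; rewrite NS; move: (size _) => s; lia.
split.
- by rewrite !mulf_neq0 // expf_neq0 // oppr_eq0 oner_neq0.
- have := congr1 (fun p => p.[-1]) Pf.
  rewrite hornerD hornerN !horner_exp hornerD hornerX -polyC1 hornerC addNr expr0n.
  have -> : (m == 0)%N = false by rewrite /m; nia.
  rewrite sub0r hornerM hornerXn => E; rewrite !exprMn etaP.
  by rewrite mulN1r E NS -exprM mulrAC -exprMn mulrNN mulr1 expr1n mul1r.
- by rewrite -mulrA sg mulr1 hornerZ.
- rewrite size_scale //; apply: leq_ltn_trans lt; rewrite leq_mul //.
  have := size_poly N.+1 (root_coef K m d); rewrite -/(root_trunc K m d N.+1) -/u; move: (size u) => s; lia.
- rewrite exprZn etaP scaleN1r opprK -exprM -NS -Pf.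
  by rewrite subrK.
Qed.

(** * Valuations trivial on K *)

(** These are the conditions of [is_place] without a uniformizer: valuations pulled back from
    Laurent series are shown to be normalised only afterwards. *)
Definition valuation (K L : fieldType) (iota : {rmorphism K -> L})
  (w : L -> int) : Prop :=
  [/\ (forall a b : L, a != 0 -> b != 0 -> w (a * b) = w a + w b),
      (forall a b : L, a != 0 -> b != 0 -> a + b != 0 ->
          Num.min (w a) (w b) <= w (a + b)) &
      (forall c : K, c != 0 -> w (iota c) = 0)].

Lemma place_valuation (K L : fieldType) (iota : {rmorphism K -> L}) w :
  is_place iota w -> valuation iota w.
Proof. by case. Qed.

(* [w 0] is a junk value, so [0] is made to have every valuation. *)
Definition vge (L : fieldType) (w : L -> int) (k : int) (z : L) : bool :=
  (z == 0) || (k <= w z).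

Section Valuation.
Variables (K L : fieldType) (iota : {rmorphism K -> L}) (w : L -> int).
Hypothesis val_w : valuation iota w.
Implicit Types (a b z : L).

Lemma valuationM a b : a != 0 -> b != 0 -> w (a * b) = w a + w b.
Proof. by case: val_w => + _ _; apply. Qed.

Lemma valuationC (c : K) : c != 0 -> w (iota c) = 0.
Proof. by case: val_w => _ _; apply. Qed.

Lemma valuation1 : w 1 = 0.
Proof. by rewrite -(rmorph1 iota) valuationC ?oner_neq0. Qed.

Lemma valuationN z : w (- z) = w z.
Proof.
have [->|z0] := eqVneq z 0; first by rewrite oppr0.
by rewrite -mulN1r valuationM ?oppr_eq0 ?oner_neq0 // -(rmorphN1 iota) valuationC ?add0r // oppr_eq0 oner_neq0.
Qed.

Lemma valuationV z : z != 0 -> w z^-1 = - w z.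
Proof.
move=> z0; have := valuation1; rewrite -(mulfV z0) valuationM ?invr_eq0 //; lia.
Qed.

Lemma valuationX z n : z != 0 -> w (z ^+ n) = n%:Z * w z.
Proof.
move=> z0; elim: n => [|n IHn]; first by rewrite expr0 valuation1 mul0r.
by rewrite exprS valuationM ?expf_neq0 // IHn intS mulrDl mul1r.
Qed.

Lemma vge_neq0 k z : z != 0 -> vge w k z = (k <= w z).
Proof. by rewrite /vge => /negPf ->. Qed.

Lemma vge0 k : vge w k 0.
Proof. by rewrite /vge eqxx. Qed.

Lemma vgeW i j z : (j <= i)%R -> vge w i z -> vge w j z.
Proof. by rewrite /vge => ji /orP[->//|iz]; rewrite (le_trans ji iz) orbT. Qed.

Lemma vgeD k a b : vge w k a -> vge w k b -> vge w k (a + b).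
Proof.
have [->|a0] := eqVneq a 0; first by rewrite add0r.
have [->|b0] := eqVneq b 0; first by rewrite addr0.
have [->|ab0] := eqVneq (a + b) 0; first by rewrite vge0.
rewrite !vge_neq0 // => ka kb.
case: val_w => _ /(_ a b a0 b0 ab0) H _; apply: le_trans H.
by rewrite le_min ka.
Qed.

Lemma vgeN k z : vge w k (- z) = vge w k z.
Proof. by rewrite /vge oppr_eq0 valuationN. Qed.

Lemma vgeM i j a b : vge w i a -> vge w j b -> vge w (i + j) (a * b).
Proof.
rewrite /vge => /orP[/eqP->|ia]; first by rewrite mul0r eqxx.
move=> /orP[/eqP->|jb]; first by rewrite mulr0 eqxx.
have [->|a0] := eqVneq a 0; first by rewrite mul0r eqxx.
have [->|b0] := eqVneq b 0; first by rewrite mulr0 eqxx.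
by rewrite valuationM // lerD ?orbT.
Qed.

Lemma vge_sum (I : Type) (r : seq I) (P : pred I) (F : I -> L) k :
  (forall i, P i -> vge w k (F i)) -> vge w k (\sum_(i <- r | P i) F i).
Proof. by move=> H; elim/big_ind: _ => //; [exact: vge0 | exact: vgeD]. Qed.

Lemma vgeC (c : K) : vge w 0 (iota c).
Proof.
by have [->|c0] := eqVneq c 0; [rewrite rmorph0 vge0 | rewrite /vge valuationC // lexx orbT].
Qed.

Lemma vgeX n z : vge w 0 z -> vge w 0 (z ^+ n).
Proof.
move=> z0; elim: n => [|n IHn]; first by rewrite expr0 -(rmorph1 iota) vgeC.
by rewrite exprS -[0]addr0 vgeM.
Qed.

(** The ultrametric inequality for z + y and for z = (z + y) - y gives both bounds. Phrasing the
    hypothesis with [vge] admits y = 0. *)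
Lemma val_dominant z y : z != 0 -> vge w (w z + 1) y ->
  z + y != 0 /\ w (z + y) = w z.
Proof.
move=> z0; have [->|y0] := eqVneq y 0; first by rewrite addr0.
rewrite vge_neq0 // => zy.
have zy0 : z + y != 0.
  by apply/eqP => /eqP; rewrite addr_eq0 => /eqP zE; move: zy; rewrite zE valuationN; lia.
split => //.
have : vge w (w z) (z + y) by apply: vgeD; rewrite vge_neq0 //; lia.
rewrite vge_neq0 // => le1.
have [//|/eqP ne] := eqVneq (w (z + y)) (w z).
have : vge w (w z + 1) (z + y + (- y)).
  by apply: vgeD; rewrite ?vgeN vge_neq0 //; lia.
by rewrite addrK vge_neq0 //; lia.
Qed.

(** Among the nonzero terms exactly one has least value, and it dominates the others; zero terms are
    excluded because their value is junk. The induction compares the head with the sum of the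
    tail. *)
Lemma val_sum_distinct (I : eqType) (r : seq I) (F : I -> L) : uniq r ->
  {in r &, forall i j, F i != 0 -> F j != 0 -> w (F i) = w (F j) -> i = j} ->
  {in r, forall k, F k != 0 -> exists2 i, i \in r & [/\ F i != 0,
    \sum_(j <- r) F j != 0, w (\sum_(j <- r) F j) = w (F i) &
    {in r, forall j, F j != 0 -> w (F i) <= w (F j)}]}.
Proof.
elim: r => [|x r IHr] //= /andP[xr ur] inj k kr Fk0.
have inj' : {in r &, forall i j, F i != 0 -> F j != 0 -> w (F i) = w (F j) -> i = j}.
  by move=> i j ir jr; apply: inj; rewrite inE ?ir ?jr orbT.
rewrite big_cons.
have [Fx0|Fx0] := eqVneq (F x) 0.
  have kr' : k \in r.
    by move: kr; rewrite inE => /orP[/eqP kx|//]; rewrite kx Fx0 eqxx in Fk0.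
  have [i ir [Fi0 S0 wS le]] := IHr ur inj' k kr' Fk0.
  rewrite Fx0 add0r; exists i; first by rewrite inE ir orbT.
  by split=> // j; rewrite inE => /orP[/eqP->|/le//]; rewrite Fx0 eqxx.
have [/hasP[k' k'r Fk'0]|/hasPn none] := boolP (has (fun j => F j != 0) r).
  have [i ir [Fi0 S0 wS le]] := IHr ur inj' k' k'r Fk'0.
  have ne : w (F x) <> w (F i).
    move/(inj x i) => xi; move: xr; rewrite xi ?ir //; first exact: mem_head.
    by rewrite inE ir orbT.
  have [lt|ge] := ltP (w (F x)) (w (F i)).
    exists x; first exact: mem_head.
    have [|? ?] := @val_dominant (F x) (\sum_(j <- r) F j) Fx0.
      by rewrite vge_neq0 // wS lezD1.
    split=> // j; rewrite inE => /orP[/eqP->//|jr Fj0].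
    exact: le_trans (ltW lt) (le j jr Fj0).
  exists i; first by rewrite inE ir orbT.
  have [|S1 S2] := @val_dominant (\sum_(j <- r) F j) (F x) S0.
    by rewrite vge_neq0 // wS lezD1 lt_neqAle ge andbT; apply/eqP => /esym.
  rewrite addrC S2 wS.
  by split=> // j; rewrite inE => /orP[/eqP->//|/le//].
exists x; first exact: mem_head.
have -> : \sum_(j <- r) F j = 0.
  by rewrite big_seq big1 // => j /none; rewrite negbK => /eqP.
rewrite addr0; split=> // j; rewrite inE => /orP[/eqP->//|/none]; rewrite negbK => ->//.
Qed.

Section Polynomial.
Variables (X : L).
Local Notation "p ^X" := ((map_poly iota p).[X]) (at level 2, format "p ^X").
Implicit Type p : {poly K}.

Lemma vge_poly p : vge w 0 X -> vge w 0 p^X.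
Proof.
move=> X0; rewrite horner_coef; apply: vge_sum => i _.
by rewrite -[0]addr0 vgeM ?vgeX // coef_map vgeC.
Qed.

(** The nonzero monomials of p have distinct values i w(X), and since w(X) < 0 the leading one is
    least. *)
Lemma val_poly_pole p : w X < 0 -> X != 0 -> p != 0 ->
  p^X != 0 /\ w p^X = (size p).-1%:Z * w X.
Proof.
move=> wX X0 p0.
have sp : ((size p).-1 < size p)%N by rewrite prednK // size_poly_gt0.
pose F (i : 'I_(size p)) : L := (map_poly iota p)`_i * X ^+ i.
have -> : p^X = \sum_(i < size p) F i by rewrite horner_coef size_map_poly.
have wF i : F i != 0 -> w (F i) = i%:Z * w X.
  rewrite /F mulf_eq0 negb_or coef_map => /andP[Fi Xi]; rewrite valuationM // valuationX // valuationC ?add0r //.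
  by rewrite -(fmorph_eq0 iota).
have [|i j _ _ Fi Fj||i _ [Fi0 S0 wS le]] :=
  @val_sum_distinct _ (index_enum 'I_(size p)) F _ _ (Ordinal sp) (mem_index_enum _).
- exact: index_enum_uniq.
- rewrite !wF // => /eqP; rewrite -subr_eq0 -mulrBl mulf_eq0 => /orP[|]; last by move/eqP; lia.
  by rewrite subr_eq0 => /eqP [] /val_inj.
- by rewrite /F /= mulf_neq0 ?expf_neq0 // coef_map fmorph_eq0 -/(lead_coef p) lead_coef_eq0.
split=> //; rewrite wS wF //.
have Fl : F (Ordinal sp) != 0.
  by rewrite /F /= mulf_neq0 ?expf_neq0 // coef_map fmorph_eq0 -/(lead_coef p) lead_coef_eq0.
have := le _ (mem_index_enum _) Fl; rewrite !wF //= => H.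
have : (i <= (size p).-1)%N by rewrite -ltnS prednK ?ltn_ord // size_poly_gt0.
rewrite leq_eqVlt => /orP[/eqP->//|lt]; by move: H; rewrite ler_nM2r // lez_nat leqNgt lt.
Qed.

Variable a : K.
Hypotheses (Xa0 : X - iota a != 0) (wXa : 0 < w (X - iota a)).

Lemma poly_taylor p : exists2 q : {poly K},
  p = q * ('X - a%:P) + p.[a]%:P & p^X = q^X * (X - iota a) + iota p.[a].
Proof.
have : root (p - p.[a]%:P) a by rewrite rootE hornerD hornerN hornerC subrr.
move/factor_theorem => [q /eqP]; rewrite subr_eq => /eqP pq; exists q => //.
rewrite {1}pq rmorphD rmorphM /= rmorphB /= map_polyX !map_polyC /=.
by rewrite hornerD hornerM hornerXsubC hornerC.
Qed.

Lemma vge0_center : vge w 0 X.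
Proof.
rewrite -(subrK (iota a) X); apply: vgeD; last exact: vgeC.
by rewrite vge_neq0 // ltW.
Qed.

Lemma vge_poly_center p : vge w 1 (p^X - iota p.[a]).
Proof.
have [q _ ->] := poly_taylor p; rewrite addrK -[1]add0r vgeM ?vge_poly ?vge0_center //.
by rewrite vge_neq0 //; lia.
Qed.

Lemma val_poly_center p : p.[a] != 0 -> p^X != 0 /\ w p^X = 0.
Proof.
move=> pa; have := vge_poly_center p.
have ipa : iota p.[a] != 0 by rewrite fmorph_eq0.
have := @val_dominant (iota p.[a]) (p^X - iota p.[a]) ipa.
by rewrite [iota _ + _]addrC subrK valuationC // add0r => H /H.
Qed.

Lemma val_poly_root p : p != 0 ->
  p^X != 0 /\ w p^X = (mup a p)%:Z * w (X - iota a).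
Proof.
move=> p0; have [k [q]] := multiplicity_XsubC p a; rewrite p0 /= => nq pE.
have q0 : q != 0 by apply: contraNneq nq => ->; rewrite root0.
have [qX0 wq] := @val_poly_center q nq.
have pX : p^X = q^X * (X - iota a) ^+ k.
  by rewrite pE rmorphM rmorphXn /= rmorphB /= map_polyX map_polyC hornerM horner_exp hornerXsubC.
rewrite pX mulf_neq0 ?expf_neq0 // valuationM ?expf_neq0 // wq valuationX // add0r; split=> //.
by rewrite pE mupMr // mup_XsubCX eqxx.
Qed.
End Polynomial.

(** This gives the transcendence of x in the Laurent parametrisations, where the value of x or of x
    - a is explicit. *)
Lemma transcendental_of_val (X : L) (a : K) :
  (X != 0 /\ w X < 0) \/ (X - iota a != 0 /\ 0 < w (X - iota a)) ->
  forall p : {poly K}, p != 0 -> (map_poly iota p).[X] != 0.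
Proof.
by case=> -[X0 wX] p p0; [case: (val_poly_pole wX X0 p0) | case: (val_poly_root X0 wX p0)].
Qed.
End Valuation.

(** * Polynomials in x and y evaluated on the curve, and normal forms in the function field *)

Section Ev2.
Variables (K L : fieldType) (iota : {rmorphism K -> L}) (X Y : L).
Implicit Types (c : {poly K}) (p q : {poly {poly K}}).

(** [ev2] rebuilt from nested ring morphisms, convertible to it, so that morphism lemmas apply. *)
Definition evX : {rmorphism {poly K} -> L} :=
  horner_morph (fun c : K => mulrC X (iota c) : GRing.comm X (iota c)).

Definition evXY : {rmorphism {poly {poly K}} -> L} :=
  horner_morph (fun c => mulrC Y (evX c) : GRing.comm Y (evX c)).

Arguments evX : simpl never.
Arguments evXY : simpl never.

Lemma evXE c : (map_poly iota c).[X] = evX c. Proof. by []. Qed.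
Lemma ev2E p : ev2 iota X Y p = evXY p. Proof. by []. Qed.
Lemma evXC (a : K) : evX a%:P = iota a. Proof. exact: horner_morphC. Qed.
Lemma evX_X : evX 'X = X. Proof. exact: horner_morphX. Qed.
Lemma evXYC c : evXY c%:P = evX c. Proof. exact: horner_morphC. Qed.
Lemma evXY_X : evXY 'X = Y. Proof. exact: horner_morphX. Qed.
Lemma evXYZ c p : evXY (c *: p) = evX c * evXY p.
Proof. by rewrite -mul_polyC rmorphM /= evXYC. Qed.

Lemma evXY_sum d p : (size p <= d)%N -> evXY p = \sum_(i < d) evX p`_i * Y ^+ i.
Proof.
move=> sp; rewrite -ev2E /ev2 (@horner_coef_wide _ d); last first.
  exact: leq_trans (size_poly _ _) sp.
by apply: eq_bigr => i _; rewrite coef_map_id0 // raddf0 horner0.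
Qed.
End Ev2.

Definition curve_poly (K : fieldType) (d : nat) (f : {poly K}) : {poly {poly K}} :=
  'X^d - f%:P.

Section CurvePoly.
Variables (K : fieldType) (d : nat) (f : {poly K}).
Hypothesis d0 : (0 < d)%N.
Local Notation W := (curve_poly d f).

Lemma size_curve_poly : size W = d.+1.
Proof.
by rewrite size_polyDl ?size_polyXn // size_polyN ltnS (leq_trans (size_polyC_leq1 _)).
Qed.

Lemma curve_poly_monic : W \is monic.
Proof.
rewrite monicE lead_coefDl ?lead_coefXn //.
by rewrite size_polyXn size_polyN ltnS (leq_trans (size_polyC_leq1 _)).
Qed.

Lemma curve_poly_neq0 : W != 0.
Proof. by rewrite monic_neq0 // curve_poly_monic. Qed.

Lemma curve_poly_div p : exists q r, [/\ p = q * W + r & (size r <= d)%N].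
Proof.
exists (p %/ W), (p %% W); split.
  exact: Pdiv.IdomainMonic.divp_eq curve_poly_monic p.
by rewrite -ltnS -size_curve_poly ltn_modp curve_poly_neq0.
Qed.
End CurvePoly.

Lemma size_cofactor (R : idomainType) (c : R) (p q r : {poly R}) :
  p != 0 -> c *: p = q * r -> (1 < size r)%N -> (size q < size p)%N.
Proof.
move=> p0 E r1; have [->|q0] := eqVneq q 0; first by rewrite size_poly0 size_poly_gt0.
have r0 : r != 0 by rewrite -size_poly_gt0 (ltn_trans _ r1).
have : (size (c *: p) <= size p)%N by apply: size_scale_leq.
rewrite E size_mul //; move: r1; case: (size r) => [|[|k]] // _.
by rewrite !addnS /= -addSn => /(leq_trans _); apply; apply: leq_addr.
Qed.

(** A function field model without generation by X and Y, so that Laurent parametrisations, which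
    live in a larger field, also qualify. *)
Definition on_curve (K L : fieldType) (d : nat) (f : {poly K})
    (iota : {rmorphism K -> L}) (X Y : L) : Prop :=
  Y ^+ d = (map_poly iota f).[X] /\
  (forall p : {poly K}, p != 0 -> (map_poly iota p).[X] != 0).

(** Linear independence of 1, Y, ..., Y^(d-1) over K[X]. For X, Y on the curve this amounts to
    irreducibility of y^d - f over K(x). *)
Definition free_powers (K L : fieldType) (d : nat) (iota : {rmorphism K -> L})
    (X Y : L) : Prop :=
  forall p : {poly {poly K}}, (size p <= d)%N -> p != 0 -> evXY iota X Y p != 0.

Lemma evXY_curve (K L : fieldType) d (f : {poly K}) (iota : {rmorphism K -> L}) X Y :
  Y ^+ d = (map_poly iota f).[X] -> evXY iota X Y (curve_poly d f) = 0.
Proof.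
by move=> Yd; rewrite /curve_poly rmorphB rmorphXn /= evXY_X evXYC Yd subrr.
Qed.

Section OnCurve.
Variables (K L : fieldType) (d : nat) (f : {poly K}) (iota : {rmorphism K -> L}) (X Y : L).
Hypotheses (d0 : (0 < d)%N) (crv : on_curve d f iota X Y).
Local Notation W := (curve_poly d f).
Local Notation evX := (evX iota X).
Local Notation evXY := (evXY iota X Y).
Implicit Types (c : {poly K}) (p q : {poly {poly K}}).

Lemma evX_neq0 c : c != 0 -> evX c != 0.
Proof. by case: crv => _; apply. Qed.

Lemma evX_eq0 c : (evX c == 0) = (c == 0).
Proof. by have [->|/evX_neq0/negPf //] := eqVneq c 0; rewrite rmorph0 eqxx. Qed.

Lemma evXY_curve_poly : evXY W = 0.
Proof.
by apply: evXY_curve; case: crv.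
Qed.

Lemma evXY_reduce p : exists2 r, evXY p = evXY r & (size r <= d)%N.
Proof.
have [q [r [-> sr]]] := curve_poly_div f d0 p.
by exists r => //; rewrite rmorphD rmorphM /= evXY_curve_poly mulr0 add0r.
Qed.

Lemma evXY_pseudodiv p : evXY (W %/ p) * evXY p + evXY (W %% p) = 0.
Proof.
by rewrite -rmorphM -rmorphD -Pdiv.Idomain.divp_eq evXYZ evXY_curve_poly mulr0.
Qed.

(* A proper factor of [W] over [K(X)] would vanish, or have a vanishing
   cofactor, in the field [F]. *)
Lemma free_powers_transfer (F : fieldType) (iF : {rmorphism K -> F}) (x y : F) :
  on_curve d f iF x y -> free_powers d iF x y -> free_powers d iota X Y.
Proof.
move=> [yd _] freeF p; have [s sp] := ubnP (size p).
elim: s p sp => // s IHs p sp pd p0; apply/eqP => evp.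
have [sp1|sp1] := leqP (size p) 1.
  have /eqP := evp; rewrite (size1_polyC sp1) evXYC evX_eq0.
  by move: p0; rewrite {1}(size1_polyC sp1) polyC_eq0 => /negPf ->.
have E := Pdiv.Idomain.divp_eq W p.
have sR : (size (W %% p)%R < size p)%N by rewrite ltn_modp.
have R0 : W %% p = 0.
  apply/eqP; apply: contraT => Rn0.
  have : evXY (W %% p) != 0 by apply: IHs => //; [exact: leq_trans sR sp | exact: leq_trans (ltnW sR) pd].
  by have := evXY_pseudodiv p; rewrite evp mulr0 add0r => ->; rewrite eqxx.
have lc0 : lead_coef p ^+ scalp W p != 0 by rewrite expf_neq0 // lead_coef_eq0.
rewrite R0 addr0 in E.
have D0 : W %/ p != 0.
  apply: contraNneq lc0 => D0; move/eqP: E; rewrite D0 mul0r -mul_polyC mulf_eq0 polyC_eq0.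
  by rewrite (negPf (curve_poly_neq0 f d0)) orbF.
have sD : (size (W %/ p)%R <= d)%N.
  by rewrite -ltnS -(size_curve_poly f d0) (size_cofactor (curve_poly_neq0 f d0) E sp1).
(* A nonzero K[x]-multiple of [W] is now a product of two polynomials of degree below d in y. At (x,
   y) both factors are nonzero, while [W] vanishes. *)
have := congr1 (ev2 iF x y) E.
rewrite !ev2E evXYZ rmorphM /= evXY_curve // mulr0.
by move/esym/eqP; rewrite mulf_eq0 (negPf (freeF _ sD D0)) (negPf (freeF _ pd p0)).
Qed.

Hypothesis free : free_powers d iota X Y.

(** Euclid's algorithm against [W]: at (X, Y), multiplying p by -(W %/ p) yields W %% p, which is
    smaller and, by freeness, nonzero. It stops at a polynomial in x alone. *)
Lemma exists_norm p : (size p <= d)%N -> p != 0 ->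
  exists q c, c != 0 /\ evXY (p * q) = evX c.
Proof.
have [s sp] := ubnP (size p); elim: s p sp => // s IHs p sp pd p0.
have [sp1|sp1] := leqP (size p) 1.
  exists 1, p`_0; rewrite mulr1 (size1_polyC sp1) evXYC coefC; split=> //.
  by move: p0; rewrite {1}(size1_polyC sp1) polyC_eq0.
have E := Pdiv.Idomain.divp_eq W p.
have sR : (size (W %% p)%R < size p)%N by rewrite ltn_modp.
have lc0 : lead_coef p ^+ scalp W p != 0 by rewrite expf_neq0 // lead_coef_eq0.
have E2 := evXY_pseudodiv p.
have R0 : W %% p != 0.
  apply: contra_neq lc0 => R0; move: E2; rewrite R0 rmorph0 addr0 => /eqP.
  rewrite mulf_eq0 (negPf (free pd p0)) orbF => evD.
  have [D0|D0] := eqVneq (W %/ p) 0.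
    move/eqP: E; rewrite R0 D0 mul0r addr0 -mul_polyC mulf_eq0 polyC_eq0.
    by rewrite (negPf (curve_poly_neq0 f d0)) orbF => /eqP.
  have sD : (size (W %/ p)%R <= d)%N.
    rewrite R0 addr0 in E.
    by rewrite -ltnS -(size_curve_poly f d0) (size_cofactor (curve_poly_neq0 f d0) E sp1).
  by move: (free sD D0); rewrite evD.
have [q [c [c0 evq]]] := IHs (W %% p) (leq_trans sR sp) (leq_trans (ltnW sR) pd) R0.
exists (- (W %/ p) * q), c; split=> //.
rewrite -evq !rmorphM rmorphN /=; move/eqP: E2; rewrite addrC addr_eq0 => /eqP ->.
by ring.
Qed.

End OnCurve.

Lemma model_on_curve (K L : fieldType) d (f : {poly K}) (iota : {rmorphism K -> L}) X Y :
  is_function_field_model d f iota X Y -> on_curve d f iota X Y.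
Proof. by case. Qed.

(** The multiplier from [exists_norm] turns the denominator into a polynomial in X, and the
    numerator is then reduced modulo [W]. *)
Lemma model_coord (K L : fieldType) d (f : {poly K}) (iota : {rmorphism K -> L}) X Y :
  (0 < d)%N -> is_function_field_model d f iota X Y -> free_powers d iota X Y ->
  forall z, exists (p : {poly {poly K}}) (c : {poly K}), [/\ c != 0, (size p <= d)%N & z = evXY iota X Y p / evX iota X c].
Proof.
move=> d0 mdl free z; have crv := model_on_curve mdl.
case: mdl => _ _ /(_ z) [p [q [q0 ->]]].
have [q' qq' sq'] := evXY_reduce d0 crv q.
have q'0 : q' != 0 by apply: contraNneq q0 => E; rewrite ev2E qq' E rmorph0.
have [r [c [c0 evr]]] := exists_norm d0 crv free sq' q'0.
have [p' pp' sp'] := evXY_reduce d0 crv (p * r).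
have cX := evX_neq0 crv c0.
exists p', c; split=> //; rewrite -pp' -evr !rmorphM /= !ev2E -qq'.
rewrite -ev2E in q0 *.
have r0 : evXY iota X Y r != 0.
  by apply: contraNneq cX => r0; rewrite -evr rmorphM /= r0 mulr0.
by rewrite -mulf_div mulfV // mulr1.
Qed.

(** * Values of polynomials in x and y: total ramification, and centres at affine points *)

Section ValuationOnCurve.
Variables (K L : fieldType) (d : nat) (iota : {rmorphism K -> L}) (X Y : L) (w : L -> int).
Hypotheses (d0 : (0 < d)%N) (val_w : valuation iota w).
Local Notation evX := (evX iota X).
Local Notation evXY := (evXY iota X Y).
Implicit Types (c : {poly K}) (p q : {poly {poly K}}).

(* Total ramification: the [d] terms have valuations in distinct classes modulo [d k]. *)
Lemma val_ramified (k r : int) p :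
  k != 0 -> Y != 0 -> w Y = r * k -> coprimez r d ->
  (forall c, c != 0 -> evX c != 0 /\ exists j : int, w (evX c) = j * d%:Z * k) ->
  (size p <= d)%N -> p != 0 ->
  [/\ evXY p != 0,
    exists i : 'I_d, p`_i != 0 /\ w (evXY p) = w (evX p`_i) + i%:Z * w Y &
    forall i, p`_i != 0 -> w (evXY p) <= w (evX p`_i) + i%:Z * w Y].
Proof.
move=> k0 Y0 wY cop wX sp p0; rewrite (evXY_sum _ _ _ sp).
pose F (i : 'I_d) : L := evX p`_i * Y ^+ i.
have Fp i : (F i != 0) = (p`_i != 0).
  rewrite /F mulf_eq0 expf_eq0 (negPf Y0) andbF orbF.
  by have [->|/wX[-> _]//] := eqVneq p`_i 0; rewrite rmorph0 eqxx.
have wF i : F i != 0 -> w (F i) = w (evX p`_i) + i%:Z * w Y.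
  by rewrite Fp => /wX[ci _]; rewrite (valuationM val_w) ?expf_neq0 // (valuationX val_w).
have lp : ((size p).-1 < d)%N by move: p0; rewrite -size_poly_gt0; lia.
have Fl : F (Ordinal lp) != 0 by rewrite Fp /= -/(lead_coef p) lead_coef_eq0.
have [|i j _ _ Fi Fj||i _ [Fi0 S0 wS le]] :=
  @val_sum_distinct _ _ _ _ val_w _ (index_enum 'I_d) F _ _ (Ordinal lp) (mem_index_enum _).
- exact: index_enum_uniq.
- rewrite !wF // wY.
  move: Fi Fj; rewrite !Fp => /wX[_ [a ->]] /wX[_ [b ->]] E.
  have {}E : (i%:Z - j%:Z) * r = (b - a) * d%:Z.
    apply: (mulIf k0); apply/eqP; rewrite -subr_eq0; apply/eqP.
    transitivity (a * d%:Z * k + i%:Z * (r * k) - (b * d%:Z * k + j%:Z * (r * k))).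
      by ring.
    by rewrite E subrr.
  (* As r is prime to d, d divides i - j; both indices are below d, so they coincide. *)
  have : (d %| i%:Z - j%:Z)%Z.
    by rewrite -(@Gauss_dvdzl d _ r) ?E ?dvdz_mull // coprimez_sym.
  case/dvdzP => q ij; apply: val_inj; have := ltn_ord i; have := ltn_ord j => /=.
  case: (q =P 0) ij => [->|q0]; nia.
- exact: Fl.
split=> //; first by exists i; rewrite -Fp wS wF.
move=> j pj; have jd : (j < d)%N.
  by apply: leq_trans sp; rewrite ltnNge; apply: contraNN pj => /leq_sizeP ->.
have := le (Ordinal jd) (mem_index_enum _); rewrite Fp => /(_ pj).
by rewrite -wS (wF (Ordinal jd)) ?Fp.
Qed.

Lemma vge_evXY p : vge w 0 X -> vge w 0 Y -> vge w 0 (evXY p).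
Proof.
move=> X0 Y0; rewrite (evXY_sum _ _ _ (leqnn _)); apply: (vge_sum val_w) => i _.
by rewrite -[0]addr0 (vgeM val_w) ?(vgeX val_w) //; apply: (vge_poly val_w).
Qed.

Variables (a b : K).
Hypotheses (Xa0 : X - iota a != 0) (wXa : 0 < w (X - iota a)) (wYb : vge w 1 (Y - iota b)).

Lemma vge0_Y : vge w 0 Y.
Proof.
rewrite -(subrK (iota b) Y); apply: (vgeD val_w); last exact: (vgeC val_w).
exact: vgeW wYb.
Qed.

Lemma bipoly_taylor p : exists q,
  p = q * ('X - b%:P%:P) + (p.[b%:P])%:P.
Proof.
have : root (p - (p.[b%:P])%:P) b%:P by rewrite rootE hornerD hornerN hornerC subrr.
by move/factor_theorem => [q /eqP]; rewrite subr_eq => /eqP pq; exists q.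
Qed.

Lemma evXY_XsubC : evXY ('X - b%:P%:P) = Y - iota b.
Proof. by rewrite rmorphB /= evXY_X evXYC evXC. Qed.

Lemma vge_evXY_center p : vge w 1 (evXY p - iota p.[b%:P].[a]).
Proof.
have [q {1}->] := bipoly_taylor p.
rewrite rmorphD rmorphM /= evXY_XsubC evXYC -addrA; apply: (vgeD val_w).
  rewrite -[1]add0r (vgeM val_w) // vge_evXY ?vge0_Y //.
  exact: (vge0_center val_w Xa0 wXa).
exact: (vge_poly_center val_w).
Qed.

Lemma val_evXY_center p : p.[b%:P].[a] != 0 -> evXY p != 0 /\ w (evXY p) = 0.
Proof.
move=> pab; have := vge_evXY_center p.
have ipa : iota p.[b%:P].[a] != 0 by rewrite fmorph_eq0.
have := @val_dominant _ _ _ _ val_w (iota p.[b%:P].[a]) (evXY p - iota p.[b%:P].[a]) ipa.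
by rewrite [iota _ + _]addrC subrK (valuationC val_w) // add0r => H /H.
Qed.

End ValuationOnCurve.

(** * Formal power series *)

Definition fps (K : fieldType) : Type := nat -> K.
HB.instance Definition _ (K : fieldType) := gen_eqMixin (fps K).
HB.instance Definition _ (K : fieldType) := gen_choiceMixin (fps K).

Section PowerSeries.
Variable K : fieldType.
Implicit Types (a b c : fps K) (p q : {poly K}).

Definition fps_trunc n a : {poly K} := \poly_(i < n) a i.
Definition fps_poly p : fps K := fun i => p`_i.
Definition fps_add a b : fps K := fun i => a i + b i.
Definition fps_opp a : fps K := fun i => - a i.
Definition fps_mul a b : fps K := fun i => \sum_(j < i.+1) a j * b (i - j)%N.

Lemma fps_addA : associative fps_add.
Proof. by move=> a b c; apply/funext => i; rewrite /fps_add addrA. Qed.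
Lemma fps_addC : commutative fps_add.
Proof. by move=> a b; apply/funext => i; rewrite /fps_add addrC. Qed.
Lemma fps_add0 : left_id (fps_poly 0) fps_add.
Proof. by move=> a; apply/funext => i; rewrite /fps_add /fps_poly coef0 add0r. Qed.
Lemma fps_addN : left_inverse (fps_poly 0) fps_opp fps_add.
Proof. by move=> a; apply/funext => i; rewrite /fps_add /fps_poly coef0 addNr. Qed.

HB.instance Definition _ := GRing.isZmodule.Build (fps K) fps_addA fps_addC fps_add0 fps_addN.

(** Coefficient k of a product depends only on coefficients up to k, so the ring laws are inherited
    from polynomial truncations. *)
Lemma fps_mulE a b p q k : (forall i, (i <= k)%N -> p`_i = a i) ->
  (forall i, (i <= k)%N -> q`_i = b i) -> fps_mul a b k = (p * q)`_k.
Proof.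
move=> pa qb; rewrite coefM; apply: eq_bigr => i _.
by rewrite pa ?qb // ?leq_subr // -ltnS.
Qed.

Lemma coef_fps_trunc n a i : (i < n)%N -> (fps_trunc n a)`_i = a i.
Proof. by rewrite coef_poly => ->. Qed.

Lemma fps_mul_trunc n a b k : (k < n)%N ->
  fps_mul a b k = (fps_trunc n a * fps_trunc n b)`_k.
Proof.
by move=> kn; apply: fps_mulE => i ik; rewrite coef_fps_trunc // (leq_ltn_trans ik).
Qed.

Lemma fps_mulA : associative fps_mul.
Proof.
move=> a b c; apply/funext => k.
have -> : fps_mul a (fps_mul b c) k =
    (fps_trunc k.+1 a * (fps_trunc k.+1 b * fps_trunc k.+1 c))`_k.
  by apply: fps_mulE => i ik; [rewrite coef_fps_trunc | rewrite -fps_mul_trunc].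
rewrite mulrA; apply/esym; apply: fps_mulE => i ik.
  by rewrite -fps_mul_trunc.
by rewrite coef_fps_trunc.
Qed.

Lemma fps_mulC : commutative fps_mul.
Proof. by move=> a b; apply/funext => k; rewrite !(@fps_mul_trunc k.+1) // mulrC. Qed.

Lemma fps_mul1 : left_id (fps_poly 1) fps_mul.
Proof.
move=> a; apply/funext => k; rewrite (@fps_mulE _ _ 1 (fps_trunc k.+1 a)) //.
  by rewrite mul1r coef_fps_trunc.
by move=> i ik; rewrite coef_fps_trunc.
Qed.

Lemma fps_mulDl : left_distributive fps_mul fps_add.
Proof.
move=> a b c; apply/funext => k; rewrite /fps_add /fps_mul -big_split.
by apply: eq_bigr => i _; rewrite mulrDl.
Qed.

Lemma fps_1neq0 : fps_poly 1 != 0.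
Proof.
apply/eqP => /(congr1 (fun a : fps K => a 0%N)); rewrite /fps_poly coef1 /=.
by rewrite -[RHS]/((0 : {poly K})`_0) coef0 => /eqP; rewrite oner_eq0.
Qed.

HB.instance Definition _ := GRing.Zmodule_isComNzRing.Build (fps K)
  fps_mulA fps_mulC fps_mul1 fps_mulDl fps_1neq0.

Definition fps_unit : pred (fps K) := fun a => `[< exists b, b * a = 1 >].
Definition fps_inv a : fps K :=
  if pselect (exists b, b * a = 1) is left ex then projT1 (cid ex) else a.

Lemma fps_mulV : {in fps_unit, left_inverse 1 fps_inv *%R}.
Proof.
move=> a /asboolP ua; rewrite /fps_inv; case: pselect => // ex.
by case: (cid ex).
Qed.
Lemma fps_unitP a b : b * a = 1 -> fps_unit a.
Proof. by move=> ba; apply/asboolP; exists b. Qed.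
Lemma fps_inv_out : {in [predC fps_unit], fps_inv =1 id}.
Proof.
move=> a; rewrite inE => /asboolPn nu.
by rewrite /fps_inv; case: pselect.
Qed.

HB.instance Definition _ := GRing.ComNzRing_hasMulInverse.Build (fps K)
  fps_mulV fps_unitP fps_inv_out.

Lemma fps0E i : (0 : fps K) i = 0. Proof. exact: coef0. Qed.
Lemma fpsDE a b i : (a + b) i = a i + b i. Proof. by []. Qed.
Lemma fpsME a b i : (a * b) i = \sum_(j < i.+1) a j * b (i - j)%N. Proof. by []. Qed.

(** The order of the zero series is the junk value 0. *)
Definition fps_ord a : nat :=
  if pselect (exists i, a i != 0) is left ex then ex_minn ex else 0%N.

Lemma fps_ordP a : a != 0 ->
  a (fps_ord a) != 0 /\ forall i, (i < fps_ord a)%N -> a i = 0.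
Proof.
move=> a0; rewrite /fps_ord; case: pselect => [ex|nex].
  case: ex_minnP => k ak le; split=> // i ik.
  by apply/eqP; apply: contraTT ik => /le; rewrite -leqNgt.
case/eqP: a0; apply/funext => i; rewrite fps0E; apply/eqP; apply: contra_notT nex.
by exists i.
Qed.

Lemma fps_ord_eq a k : a k != 0 -> (forall i, (i < k)%N -> a i = 0) ->
  a != 0 /\ fps_ord a = k.
Proof.
move=> ak lt; have a0 : a != 0 by apply: contraNneq ak => ->; rewrite fps0E.
split=> //; have [ao lo] := fps_ordP a0.
case: (ltngtP (fps_ord a) k) => // [/lt E|/lo E]; first by rewrite E eqxx in ao.
by rewrite E eqxx in ak.
Qed.

Lemma fps_ordM a b : a != 0 -> b != 0 ->
  a * b != 0 /\ fps_ord (a * b) = (fps_ord a + fps_ord b)%N.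
Proof.
move=> /fps_ordP[ai alt] /fps_ordP[bj blt].
move: (fps_ord a) (fps_ord b) ai alt bj blt => i j ai alt bj blt.
apply: fps_ord_eq.
  have lti : (i < (i + j).+1)%N by rewrite ltnS leq_addr.
  rewrite fpsME (bigD1 (Ordinal lti)) //= addKn big1 ?addr0 ?mulf_neq0 // => l li.
  have [lt|gt|eq] := ltngtP l i; [by rewrite alt ?mul0r | | by case/eqP: li; apply: val_inj].
  by rewrite blt ?mulr0 //; have := ltn_ord l; lia.
move=> k kij; rewrite fpsME big1 // => l _.
have [lt|ge] := ltnP l i; first by rewrite alt ?mul0r.
by rewrite blt ?mulr0 //; have := ltn_ord l; lia.
Qed.

Lemma fps_integral a b : a * b = 0 -> (a == 0) || (b == 0).
Proof.
move=> /eqP; apply: contraTT; rewrite negb_or => /andP[a0 b0].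
by case: (fps_ordM a0 b0).
Qed.

HB.instance Definition _ := GRing.ComUnitRing_isIntegral.Build (fps K) fps_integral.

Lemma fps_poly_is_zmod_morphism : zmod_morphism fps_poly.
Proof. by move=> p q; apply/funext => i; rewrite /fps_poly coefB. Qed.
Lemma fps_poly_is_monoid_morphism : monoid_morphism fps_poly.
Proof.
split=> // p q; apply/funext => i; rewrite /fps_poly; apply/esym.
exact: fps_mulE.
Qed.
HB.instance Definition _ := GRing.isZmodMorphism.Build {poly K} (fps K) fps_poly fps_poly_is_zmod_morphism.
HB.instance Definition _ := GRing.isMonoidMorphism.Build {poly K} (fps K) fps_poly fps_poly_is_monoid_morphism.

Lemma fps_expE a p n k : (forall i, (i <= k)%N -> p`_i = a i) -> 
  forall i, (i <= k)%N -> (p ^+ n)`_i = (a ^+ n) i.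
Proof.
move=> pa; elim: n => [|n IHn] i ik; first by rewrite !expr0.
rewrite !exprS; apply/esym; apply: fps_mulE => j ji; first by apply: pa; apply: leq_trans ik.
by apply: IHn; apply: leq_trans ik.
Qed.

Lemma fps_ordD a b : a != 0 -> b != 0 -> a + b != 0 ->
  (minn (fps_ord a) (fps_ord b) <= fps_ord (a + b)%R)%N.
Proof.
move=> /fps_ordP[_ alt] /fps_ordP[_ blt] /fps_ordP[ab _]; rewrite leqNgt.
apply: contra ab; rewrite ltn_min => /andP[la lb].
by rewrite fpsDE alt // blt // addr0.
Qed.

End PowerSeries.

(** * Roots of power series by Newton iteration *)

Section SeriesRoot.
Variables (K : fieldType) (d : nat) (h : {poly K}) (b : K).
Hypotheses (d0 : (d%:R : K) != 0) (b0 : b != 0) (hb : h.[0] = b ^+ d).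

(** Step k corrects the coefficient of t^k: its error is divided by d b^(d-1), the derivative of z^d
    at z = b. *)
Fixpoint root_approx (k : nat) : {poly K} :=
  if k is k'.+1 then
    root_approx k' + (((h - root_approx k' ^+ d)`_k / (d%:R * b ^+ d.-1)) *: 'X^k)
  else b%:P.

Lemma root_approx_stable k j i : (i <= k)%N -> (root_approx (k + j))`_i = (root_approx k)`_i.
Proof.
move=> ik; elim: j => [|j IHj]; first by rewrite addn0.
rewrite addnS /= coefD IHj coefZ coefXn.
by rewrite (_ : i == _ = false) ?mulr0 ?addr0 //; apply/eqP; lia.
Qed.

Lemma root_approx0 k : (root_approx k).[0] = b.
Proof. by rewrite horner_coef0 -[k]add0n root_approx_stable // coefC. Qed.

Lemma root_approxP k i : (i <= k)%N -> (root_approx k ^+ d)`_i = h`_i.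
Proof.
have dgt : (0 < d)%N by rewrite lt0n; apply: contraNneq d0 => ->.
elim: k i => [|k IHk] i.
  by rewrite leqn0 => /eqP->; rewrite -!horner_coef0 horner_exp hornerC hb.
rewrite leq_eqVlt /=; set c := _ / _; set p := root_approx k.
(* The difference of the d-th powers is factored. The cofactor sum has constant term d b^(d-1), so
   coefficient k + 1 changes by exactly c d b^(d-1) and lower ones are kept. *)
have E : (p + c *: 'X^(k.+1)) ^+ d = p ^+ d +
    c *: ('X^(k.+1) * \sum_(l < d) (p + c *: 'X^(k.+1)) ^+ (d.-1 - l) * p ^+ l).
  by rewrite -[LHS](subrK (p ^+ d)) subrXX [RHS]addrC [p + _]addrC addrK scalerAl.
rewrite E coefD coefZ coefXnM => /orP[/eqP->|]; last first.
  by rewrite ltnS => ik; rewrite ik mulr0 addr0 IHk.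
rewrite ltnn subnn -horner_coef0 horner_sum.
have -> : \sum_(l < d) ((p + c *: 'X^(k.+1)) ^+ (d.-1 - l) * p ^+ l).[0] = d%:R * b ^+ d.-1.
  rewrite (eq_bigr (fun=> b ^+ d.-1)) ?sumr_const ?card_ord ?mulr_natl // => l _.
  rewrite hornerM !horner_exp hornerD hornerZ hornerXn root_approx0 expr0n mulr0 addr0.
  by rewrite -exprD subnK //; have := ltn_ord l; lia.
rewrite /c divfK ?mulf_neq0 ?expf_neq0 // coefB addrC subrK //.
Qed.

Lemma fps_root : exists2 y : fps K, y ^+ d = fps_poly h & y 0%N = b.
Proof.
(* The root is read off the diagonal: coefficient i is final from approximation i onwards. *)
exists (fun i => (root_approx i)`_i); last by rewrite -horner_coef0 root_approx0.
apply/funext => k; rewrite -(@fps_expE _ _ (root_approx k) _ k) ?root_approxP // => i ik.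
by rewrite -(subnKC ik) root_approx_stable.
Qed.
End SeriesRoot.

(** * The order valuation on Laurent series, as fractions of power series *)

Section FractionValuation.
Variable K : fieldType.
Local Notation F := {fraction (fps K)}.
Local Notation "a %:F" := (@FracField.tofrac (fps K) a).

Lemma frac_repr (z : F) : exists a b : fps K, b != 0 /\ z = a%:F / b%:F.
Proof.
elim/quotW: z => x; exists (\n_x), (\d_x); split; first exact: denom_ratioP.
apply: (canRL (mulfK _)); first by rewrite tofrac_eq0 denom_ratioP.
unlock FracField.tofrac; rewrite -[LHS]FracField.pi_mul.
apply/eqmodP; rewrite /= FracField.equivfE /FracField.mulf.
by rewrite !numden_Ratio ?mulf_neq0 ?oner_eq0 ?denom_ratioP // !mulr1 mulrC.
Qed.

(** Computed from a chosen fraction; [frac_valE] shows that the choice is immaterial for nonzero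
    z. *)
Definition frac_val (z : F) : int :=
  let: exist a ex := cid (frac_repr z) in
  let: exist b _ := cid ex in (fps_ord a)%:Z - (fps_ord b)%:Z.

Lemma frac_valE (a b : fps K) : a != 0 -> b != 0 ->
  frac_val (a%:F / b%:F) = (fps_ord a)%:Z - (fps_ord b)%:Z.
Proof.
move=> a0 b0; rewrite /frac_val.
case: cid => a' ex; case: cid => b' [b'0 E].
have {}E : a * b' = a' * b.
  apply/eqP; rewrite -tofrac_eq !tofracM; apply/eqP.
  have bF : b%:F != 0 by rewrite tofrac_eq0.
  have bF' : b'%:F != 0 by rewrite tofrac_eq0.
  by move/eqP: E; rewrite eqr_div // => /eqP.
have a'0 : a' != 0.
  apply: contra_neq (mulf_neq0 a0 b'0) => a'0; by rewrite E a'0 mul0r.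
have [_] := fps_ordM a0 b'0; rewrite E.
by have [_ ->] := fps_ordM a'0 b0; lia.
Qed.

Definition frac_const : {rmorphism K -> F} :=
  (@FracField.tofrac (fps K)) \o (@fps_poly K) \o (@polyC K).

Lemma frac_const_def c : frac_const c = (fps_poly c%:P)%:F. Proof. by []. Qed.

Lemma frac_val_tofrac (a : fps K) : a != 0 -> frac_val a%:F = (fps_ord a)%:Z.
Proof.
move=> a0; rewrite -[a%:F]divr1 -(tofrac1 (fps K)) frac_valE ?oner_neq0 //.
suff [_ ->] : (1 : fps K) != 0 /\ fps_ord (1 : fps K) = 0%N by rewrite subr0.
by apply: fps_ord_eq => //; rewrite -[X in X != 0]/((1 : {poly K})`_0) coef1 oner_neq0.
Qed.

Lemma frac_valuation : valuation frac_const frac_val.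
Proof.
split.
- move=> z1 z2; have [a1 [b1 [b10 ->]]] := frac_repr z1; have [a2 [b2 [b20 ->]]] := frac_repr z2.
  rewrite !mulf_eq0 !invr_eq0 !tofrac_eq0 (negPf b10) (negPf b20) !orbF => a10 a20.
  have [a0 oa] := fps_ordM a10 a20; have [b0 ob] := fps_ordM b10 b20.
  by rewrite mulf_div -!tofracM !frac_valE // oa ob; lia.
- move=> z1 z2; have [a1 [b1 [b10 ->]]] := frac_repr z1; have [a2 [b2 [b20 ->]]] := frac_repr z2.
  rewrite !mulf_eq0 !invr_eq0 !tofrac_eq0 (negPf b10) (negPf b20) !orbF => a10 a20.
  have b10F : b1%:F != 0 by rewrite tofrac_eq0.
  have b20F : b2%:F != 0 by rewrite tofrac_eq0.
  rewrite addf_div // -!tofracM -tofracD mulf_eq0 invr_eq0 !tofrac_eq0.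
  have [b0 ob] := fps_ordM b10 b20; rewrite (negPf b0) orbF => s0.
  have [c1 oc1] := fps_ordM a10 b20; have [c2 oc2] := fps_ordM a20 b10.
  have := fps_ordD c1 c2 s0; rewrite !frac_valE // oc1 oc2 ob.
  move: (fps_ord (_ + _)) (fps_ord a1) (fps_ord a2) (fps_ord b1) (fps_ord b2) => s i1 i2 j1 j2; lia.
- move=> c c0; have cP : fps_poly c%:P != 0 /\ fps_ord (fps_poly c%:P) = 0%N.
    by apply: fps_ord_eq => //; rewrite /fps_poly coefC.
  by rewrite frac_const_def frac_val_tofrac; case: cP => // _ ->.
Qed.
End FractionValuation.

(** * Pulling a valuation back to an arbitrary model *)

Section Transfer.
Variables (K L F : fieldType) (d : nat) (f : {poly K}).
Variables (iota : {rmorphism K -> L}) (X Y : L) (iF : {rmorphism K -> F}) (x y : F).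
Variable wF : F -> int.
Hypotheses (d0 : (0 < d)%N) (mdl : is_function_field_model d f iota X Y)
  (free : free_powers d iota X Y) (crvF : on_curve d f iF x y)
  (freeF : free_powers d iF x y) (val_wF : valuation iF wF).
Let crv := model_on_curve mdl.
Local Notation evL := (evXY iota X Y).
Local Notation evF := (evXY iF x y).

(** Modulo the monic [W], p becomes a polynomial of degree below d in y, and freeness in both fields
    lets its value vanish only when that remainder is zero. *)
Lemma evXY_transfer0 p : (evL p == 0) = (evF p == 0).
Proof.
have [q [r [-> sr]]] := curve_poly_div f d0 p.
rewrite !rmorphD !rmorphM /= !(@evXY_curve _ _ d f) ?(proj1 crv) ?(proj1 crvF) //.
rewrite !mulr0 !add0r; have [->|r0] := eqVneq r 0; first by rewrite !rmorph0 !eqxx.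
by rewrite (negPf (free sr r0)) (negPf (freeF sr r0)).
Qed.

Lemma evXY_transfer p q p' q' : evL q != 0 -> evL q' != 0 ->
  evL p / evL q = evL p' / evL q' -> evF p / evF q = evF p' / evF q'.
Proof.
move=> q0 q'0 /eqP; rewrite eqr_div // => E.
have {}E : evL (p * q' - p' * q) == 0 by rewrite rmorphB !rmorphM /= subr_eq0.
rewrite evXY_transfer0 rmorphB !rmorphM /= subr_eq0 in E.
by apply/eqP; rewrite eqr_div // -evXY_transfer0.
Qed.

Lemma model_frac z : exists p q, evL q != 0 /\ z = evL p / evL q.
Proof. by case: mdl => _ _ /(_ z). Qed.

(** L embeds in F by sending X, Y to x, y, and w is the restriction of wF. The embedding is left
    implicit: w is defined on a chosen fraction, and [evXY_transfer] gives independence of the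
    choice. *)
Lemma valuation_transfer : exists w : L -> int, valuation iota w /\
  forall p, evL p != 0 -> w (evL p) = wF (evF p).
Proof.
pose w z := let: exist p ex := cid (model_frac z) in
  let: exist q _ := cid ex in wF (evF p / evF q).
have wE p q : evL q != 0 -> w (evL p / evL q) = wF (evF p / evF q).
  move=> q0; rewrite /w; case: cid => p' ex; case: cid => q' [q'0 E].
  by congr wF; apply/esym; apply: evXY_transfer E.
have neq0 p q : evL p / evL q != 0 -> evF p / evF q != 0.
  by rewrite !mulf_eq0 !invr_eq0 !evXY_transfer0.
have evF0 q : evL q != 0 -> evF q != 0 by rewrite evXY_transfer0.
exists w; split; last first.
  move=> p p0; rewrite -[evL p]divr1 -(rmorph1 evL) wE ?rmorph1 ?oner_neq0 //.
  by rewrite divr1.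
split.
- move=> z1 z2; have [p1 [q1 [q10 ->]]] := model_frac z1; have [p2 [q2 [q20 ->]]] := model_frac z2.
  move=> z10 z20; rewrite mulf_div -!rmorphM wE; last by rewrite rmorphM mulf_neq0.
  by rewrite !wE // !rmorphM -mulf_div (valuationM val_wF) ?neq0.
- move=> z1 z2; have [p1 [q1 [q10 ->]]] := model_frac z1; have [p2 [q2 [q20 ->]]] := model_frac z2.
  move=> z10 z20; rewrite addf_div // -!rmorphM -rmorphD => z0.
  rewrite [w (evL (_ + _) / _)]wE; last by rewrite rmorphM mulf_neq0.
  have := neq0 _ _ z0; rewrite !wE // rmorphD !rmorphM -addf_div ?evF0 // => zF0.
  by case: val_wF => _ /(_ _ _ (neq0 _ _ z10) (neq0 _ _ z20) zF0).
- move=> c c0; rewrite -(evXC _ X) -(evXYC _ X Y) -[evL _]divr1 -(rmorph1 evL).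
  rewrite wE ?rmorph1 ?oner_neq0 // divr1 evXYC evXC.
  exact: (valuationC val_wF).
Qed.
End Transfer.

(** * Laurent parametrisations of the curve *)

(* Laurent series in the parameter [rho 'X], where [rho] embeds the polynomials. *)
Definition laurent_field (K F : fieldType) (iF : {rmorphism K -> F})
    (rho : {rmorphism {poly K} -> F}) (wF : F -> int) : Prop :=
  [/\ valuation iF wF, forall c, rho c%:P = iF c, rho 'X != 0 /\ wF (rho 'X) = 1 &
    forall (d : nat) (h : {poly K}) (b : K), (d%:R : K) != 0 -> b != 0 -> h.[0] = b ^+ d ->
    exists u, [/\ u ^+ d = rho h, u != 0, wF u = 0 & vge wF 1 (u - iF b)]].

Lemma exists_laurent_field (K : fieldType) : exists (F : fieldType)
  (iF : {rmorphism K -> F}) (rho : {rmorphism {poly K} -> F}) (wF : F -> int),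
  laurent_field iF rho wF.
Proof.
exists {fraction (fps K)}, (frac_const K),
  ((@FracField.tofrac (fps K)) \o (@fps_poly K)), (@frac_val K); split=> //.
- exact: frac_valuation.
- have [X0 oX] : fps_poly 'X != 0 :> fps K /\ fps_ord (fps_poly 'X : fps K) = 1%N.
    by apply: fps_ord_eq; rewrite /fps_poly ?coefX ?oner_neq0 // => -[|i] //; rewrite coefX.
  by rewrite tofrac_eq0 X0 frac_val_tofrac // oX.
move=> d h b dK b0 hb; have [u uE u0] := fps_root dK b0 hb.
have [||n0 o0] := @fps_ord_eq _ u 0; rewrite ?u0 //.
exists (FracField.tofrac u); split.
- by rewrite -tofracXn uE.
- by rewrite tofrac_eq0.
- by rewrite frac_val_tofrac // o0.
rewrite -u0 frac_const_def -tofracB; set v := u - _.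
have [->|v0] := eqVneq v 0; first by rewrite tofrac0 vge0.
rewrite vge_neq0 ?tofrac_eq0 // frac_val_tofrac // lez_nat lt0n.
apply/eqP => ov; have [+ _] := fps_ordP v0; rewrite ov /v.
by rewrite /GRing.add /= /fps_add /GRing.opp /= /fps_opp /fps_poly coefC /= subrr eqxx.
Qed.

Section Laurent.
Variables (K F : fieldType) (iF : {rmorphism K -> F}) (rho : {rmorphism {poly K} -> F}).
Variable wF : F -> int.
Hypothesis lF : laurent_field iF rho wF.
Let vF : valuation iF wF. Proof. by case: lF. Qed.
Let rhoC c : rho c%:P = iF c. Proof. by case: lF. Qed.
Let s0 : rho 'X != 0. Proof. by case: lF => _ _ []. Qed.
Let ws : wF (rho 'X) = 1. Proof. by case: lF => _ _ []. Qed.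
Let rho_root := let: And4 _ _ _ H := lF in H.
Local Notation s := (rho 'X).

Lemma laurent_comp p q : rho (p \Po q) = (map_poly iF p).[rho q].
Proof.
rewrite [p \Po q]comp_polyE rmorph_sum horner_coef size_map_poly.
by apply: eq_bigr => i _; rewrite -mul_polyC rmorphM rmorphXn rhoC coef_map.
Qed.

Variables (d : nat) (f : {poly K}).
Hypotheses (d1 : (1 < d)%N) (dK : (d%:R : K) != 0).

Lemma laurent_unramified (a b : K) : b != 0 -> b ^+ d = f.[a] ->
  exists x y : F, [/\ on_curve d f iF x y, wF (x - iF a) = 1 & vge wF 1 (y - iF b)].
Proof.
move=> b0 bd; pose q := 'X + a%:P : {poly K}.
have [|u [uE _ _ ub]] := @rho_root d (f \Po q) b dK b0.
  by rewrite horner_comp hornerD hornerX hornerC add0r.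
have xE : rho q - iF a = s by rewrite rmorphD rhoC addrK.
exists (rho q), u; split=> //.
  split; last by apply: (transcendental_of_val vF (a := a)); right; rewrite xE ws.
  by rewrite uE -laurent_comp.
by rewrite xE.
Qed.

(** Here x = a + s^d and y = s u, with u^d = g(x) and u starting with c, so that y^d = s^d g(x) =
    f(x). *)
Lemma laurent_ramified (a c : K) (g : {poly K}) : f = g * ('X - a%:P) ->
  c != 0 -> c ^+ d = g.[a] ->
  exists x y : F, [/\ on_curve d f iF x y, x - iF a != 0, wF (x - iF a) = d, y != 0 & wF y = 1].
Proof.
move=> fE c0 cd; pose q := 'X^d + a%:P : {poly K}.
have [|u [uE t0 wt _]] := @rho_root d (g \Po q) c dK c0.
  by rewrite horner_comp hornerD hornerXn hornerC expr0n -[d == 0%N]negbK -lt0n (ltnW d1) add0r.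
have xE : rho q - iF a = s ^+ d by rewrite rmorphD rmorphXn rhoC addrK.
have wx : wF (rho q - iF a) = d by rewrite xE (valuationX vF) // ws mulr1.
have x0 : rho q - iF a != 0 by rewrite xE expf_neq0.
exists (rho q), (s * u); split=> //.
- split; last by apply: (transcendental_of_val vF (a := a)); right; rewrite wx x0 ltz_nat (ltnW d1).
  rewrite exprMn uE fE rmorphM /= hornerM -(laurent_comp g).
  rewrite map_polyXsubC.
  by rewrite hornerXsubC xE mulrC.
- by rewrite mulf_neq0.
- by rewrite (valuationM vF) // ws wt.
Qed.

Lemma laurent_infinity : f \is monic ->
  exists x y : F, [/\ on_curve d f iF x y, x != 0, wF x = - d%:Z, y != 0 & wF y = - (size f).-1%:Z].
Proof.
move=> mf; set n := (size f).-1.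
have sf : size f = n.+1 by rewrite prednK // size_poly_gt0 monic_neq0.
(* [rf] is the reciprocal polynomial t^n f(1/t). Its constant term is the leading coefficient 1 of
   f, so rf(s^d) has a d-th root u starting with 1, and f(s^-d) = s^(-dn) u^d. *)
pose rf : {poly K} := \poly_(i < n.+1) f`_(n - i).
have [|u [uE t0 wt _]] := @rho_root d (rf \Po 'X^d) 1 dK (oner_neq0 _).
  rewrite horner_comp hornerXn expr0n -[d == 0%N]negbK -lt0n (ltnW d1) horner_coef0 coef_poly /=.
  by rewrite subn0 -/(lead_coef f) (monicP mf) expr1n.
have sd0 : s ^- d != 0 by rewrite invr_eq0 expf_neq0.
have wx : wF (s ^- d) = - d%:Z by rewrite (valuationV vF) ?expf_neq0 // (valuationX vF) // ws mulr1.
have sn0 : s ^- n != 0 by rewrite invr_eq0 expf_neq0.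
exists (s ^- d), (s ^- n * u); split=> //.
- split; last first.
    by apply: (transcendental_of_val vF (a := 0)); left; rewrite sd0 wx oppr_lt0 ltz_nat (ltnW d1).
  rewrite exprMn uE laurent_comp rmorphXn.
  rewrite (@horner_coef_wide _ n.+1); last by apply: leq_trans (size_poly _ _) _; apply: size_poly.
  rewrite horner_coef size_map_poly sf mulr_sumr (reindex_inj rev_ord_inj).
  apply: eq_bigr => i _; rewrite !coef_map_id0 ?rmorph0 // coef_poly.
  have -> : (rev_ord i : nat) = (n - i)%N by rewrite /= subSS.
  have lei : (i <= n)%N by rewrite -ltnS.
  rewrite ltnS leq_subr subKn // mulrCA; congr (_ * _).
  apply: (mulfI (expf_neq0 (d * i) s0)); rewrite -!exprVn -!exprM.
  rewrite [in RHS]exprVn mulfV ?expf_neq0 // mulrCA -exprD -mulnDr subnKC // mulnC.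
  by rewrite exprVn mulVf ?expf_neq0.
- by rewrite mulf_neq0.
- by rewrite (valuationM vF) // wt addr0 (valuationV vF) ?expf_neq0 // (valuationX vF) // ws mulr1.
Qed.
End Laurent.

(** * Total ramification at infinity, and existence of places on a model *)

Lemma coprime_coprimez (n d : nat) : coprime n d -> coprimez n d.
Proof. by rewrite /coprimez /gcdz /= => /eqP ->. Qed.

Section Infinity.
Variables (K L : fieldType) (d n : nat) (iota : {rmorphism K -> L}) (X Y : L).
Variables (w : L -> int) (k : int).
Hypotheses (d0 : (0 < d)%N) (cop : coprime n d) (val_w : valuation iota w)
  (X0 : X != 0) (Y0 : Y != 0) (k0 : 0 < k) (wX : w X = - (d%:Z * k)) (wY : w Y = - (n%:Z * k)).

Lemma val_evX_infinity (c : {poly K}) : c != 0 ->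
  evX iota X c != 0 /\ w (evX iota X c) = (size c).-1%:Z * w X.
Proof. by move=> c0; apply: (val_poly_pole val_w) => //; rewrite wX oppr_lt0 mulr_gt0 // ltz_nat. Qed.

(** The factor k allows use before the valuation is known to be normalised. *)
Lemma val_infinity (p : {poly {poly K}}) : (size p <= d)%N -> p != 0 ->
  [/\ evXY iota X Y p != 0,
    exists i : 'I_d, p`_i != 0 /\
      w (evXY iota X Y p) = w (evX iota X p`_i) + i%:Z * w Y &
    forall i, p`_i != 0 -> w (evXY iota X Y p) <= w (evX iota X p`_i) + i%:Z * w Y].
Proof.
have kN0 : - k != 0 by rewrite oppr_eq0 gt_eqF.
have wYk : w Y = n%:Z * - k by rewrite wY mulrN.
apply: (val_ramified d0 val_w kN0 Y0 wYk (coprime_coprimez cop)) => c c0.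
have [cX ->] := val_evX_infinity c0.
by split=> //; exists (size c).-1%:Z; rewrite wX; ring.
Qed.

Lemma free_powers_infinity : free_powers d iota X Y.
Proof. by move=> p sp p0; case: (val_infinity sp p0). Qed.
End Infinity.

Section Model.
Variables (K L : fieldType) (d n : nat) (f : {poly K}) (iota : {rmorphism K -> L}) (X Y : L).
Hypotheses (d1 : (1 < d)%N) (dK : (d%:R : K) != 0) (cop : coprime n d)
  (mf : f \is monic) (sf : size f = n.+1) (mdl : is_function_field_model d f iota X Y).
Let crv := model_on_curve mdl.
Let d0 := ltnW d1.

(** At infinity y has value -n, prime to d, while polynomials in x have values divisible by d. Hence
    the powers of y are independent in Laurent series, and this transfers to L. *)
Lemma model_free : free_powers d iota X Y.
Proof.
have [F [iF [rho [wF lF]]]] := exists_laurent_field K.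
have vF : valuation iF wF by case: lF.
have [x [y [cF x0 wx y0 wy]]] := laurent_infinity lF d1 dK mf.
apply: (free_powers_transfer d0 crv cF).
apply: (@free_powers_infinity _ _ d n _ x y _ 1 d0 cop vF x0 y0) => //.
  by rewrite wx mulr1.
by rewrite wy sf mulr1.
Qed.

Lemma model_X_neq a : X - iota a != 0.
Proof.
have := evX_neq0 crv (monic_neq0 (monicXsubC a)).
by rewrite rmorphB /= evX_X evXC.
Qed.

Lemma model_Y_neq b : Y - iota b != 0.
Proof.
have := @model_free ('X - b%:P%:P); rewrite evXY_XsubC; apply; last exact: (monic_neq0 (monicXsubC _)).
by rewrite size_XsubC.
Qed.

Lemma place_transfer (F : fieldType) (iF : {rmorphism K -> F}) x y (wF : F -> int) :
  on_curve d f iF x y -> valuation iF wF -> free_powers d iF x y ->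
  exists w, [/\ valuation iota w, forall a, w (X - iota a) = wF (x - iF a) &
    forall b, w (Y - iota b) = wF (y - iF b)].
Proof.
move=> cF vF fF; have [w [vw wE]] := valuation_transfer d0 mdl model_free cF fF vF.
exists w; split=> // [a|b].
  have := wE (('X - a%:P)%:P); rewrite !evXYC !rmorphB /= !evX_X !evXC; apply.
  exact: model_X_neq.
by have := wE ('X - b%:P%:P); rewrite !evXY_XsubC; apply; apply: model_Y_neq.
Qed.

Lemma curve_free (F : fieldType) (iF : {rmorphism K -> F}) x y :
  on_curve d f iF x y -> free_powers d iF x y.
Proof. by move=> cF; apply: (free_powers_transfer d0 cF crv model_free). Qed.

Lemma exists_place_infinity : exists2 w, is_place iota w & w X < 0.
Proof.
have [F [iF [rho [wF lF]]]] := exists_laurent_field K.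
have vF : valuation iF wF by case: lF.
have [x [y [cF x0 wx y0 wy]]] := laurent_infinity lF d1 dK mf.
have [w [vw wX wY]] := place_transfer cF vF (curve_free cF).
have {}wX : w X = - d%:Z by have := wX 0; rewrite !rmorph0 !subr0 wx.
have {}wY : w Y = - n%:Z by have := wY 0; rewrite !rmorph0 !subr0 wy sf.
have X0 : X != 0 by have := model_X_neq 0; rewrite rmorph0 subr0.
have Y0 : Y != 0 by have := model_Y_neq 0; rewrite rmorph0 subr0.
exists w; last by rewrite wX oppr_lt0 ltz_nat.
case: (vw) => M D C; split=> //.
have n0 : (0 < n)%N by move: cop; rewrite lt0n; apply: contraTneq => ->; rewrite /coprime gcd0n; lia.
(* Bezout's relation km n = kn d + 1 makes X^kn / Y^km a uniformizer, since w(X) = -d and w(Y) =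
   -n. *)
case: (egcdnP d n0) => km kn E _; exists (X ^+ kn / Y ^+ km).
rewrite mulf_neq0 ?invr_eq0 ?expf_neq0 //; split=> //.
rewrite (valuationM vw) ?invr_eq0 ?expf_neq0 // (valuationV vw) ?expf_neq0 //.
rewrite !(valuationX vw) // wX wY; move: E; rewrite (eqP cop); nia.
Qed.

Lemma exists_place_unramified (a b : K) : b != 0 -> b ^+ d = f.[a] ->
  exists2 w, is_place iota w & w (X - iota a) = 1 /\ 0 < w (Y - iota b).
Proof.
move=> b0 bd; have [F [iF [rho [wF lF]]]] := exists_laurent_field K.
have vF : valuation iF wF by case: lF.
have [x [y [cF wx wy]]] := laurent_unramified lF dK b0 bd.
have [w [vw wX wY]] := place_transfer cF vF (curve_free cF).
exists w.
  case: (vw) => M D C; split=> //; exists (X - iota a).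
  by rewrite model_X_neq wX.
rewrite wX wY wx; split=> //; move: wy; rewrite vge_neq0 ?gtz0_ge1 //.
have := curve_free cF (p := 'X - b%:P%:P); rewrite evXY_XsubC; apply.
  by rewrite size_XsubC.
exact: (monic_neq0 (monicXsubC _)).
Qed.

Lemma exists_place_ramified (a c : K) (g : {poly K}) : f = g * ('X - a%:P) ->
  c != 0 -> c ^+ d = g.[a] ->
  exists2 w, is_place iota w & w (X - iota a) = d /\ w Y = 1.
Proof.
move=> fE c0 cd; have [F [iF [rho [wF lF]]]] := exists_laurent_field K.
have vF : valuation iF wF by case: lF.
have [x [y [cF x0 wx y0 wy]]] := laurent_ramified lF d1 dK fE c0 cd.
have [w [vw wX wY]] := place_transfer cF vF (curve_free cF).
have {}wY : w Y = 1 by have := wY 0; rewrite !rmorph0 !subr0 wy.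
exists w; last by rewrite wX.
case: (vw) => M D C; split=> //; exists Y; split=> //.
by have := model_Y_neq 0; rewrite rmorph0 subr0.
Qed.
End Model.

(** * Values at an arbitrary place, at infinity or centred at an affine point *)

Section Place.
Variables (K L : fieldType) (d n : nat) (f : {poly K}) (iota : {rmorphism K -> L}) (X Y : L).
Hypotheses (d1 : (1 < d)%N) (dK : (d%:R : K) != 0) (cop : coprime n d)
  (mf : f \is monic) (sf : size f = n.+1) (mdl : is_function_field_model d f iota X Y).
Variable w : L -> int.
Hypothesis place_w : is_place iota w.
Let val_w := place_valuation place_w.
Let crv := model_on_curve mdl.
Let d0 := ltnW d1.
Let free := model_free d1 dK cop mf sf mdl.
Local Notation evX := (evX iota X).
Local Notation evXY := (evXY iota X Y).

Lemma model_X0 : X != 0.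
Proof. by have := model_X_neq mdl 0; rewrite rmorph0 subr0. Qed.

Lemma model_Y0 : Y != 0.
Proof. by have := model_Y_neq d1 dK cop mf sf mdl 0; rewrite rmorph0 subr0. Qed.

Lemma place_Y_pow : d%:Z * w Y = w (evX f).
Proof. by rewrite -(valuationX val_w) ?model_Y0 // (proj1 crv). Qed.

(** From d w(Y) = n w(X) and coprimality, w(X) = -d k and w(Y) = -n k with k > 0. Every element of L
    is some p(X, Y) / c(X), so its value is a multiple of k, and a uniformizer forces k = 1. *)
Lemma place_infinity : w X < 0 -> w X = - d%:Z /\ w Y = - n%:Z.
Proof.
move=> wX0; have f0 : f != 0 by rewrite monic_neq0.
have E : d%:Z * w Y = n%:Z * w X.
  by rewrite place_Y_pow; have [_ ->] := val_poly_pole val_w wX0 model_X0 f0; rewrite sf.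
have : (d %| w X)%Z.
  rewrite -(@Gauss_dvdzr d n) -?E ?dvdz_mulr //.
  by rewrite coprimez_sym coprime_coprimez.
case/dvdzP => j wX.
have wXj : w X = - (d%:Z * - j) by rewrite wX; ring.
have j0 : 0 < - j by nia.
have wYj : w Y = - (n%:Z * - j).
  have : d%:Z * (w Y + n%:Z * - j) = 0 by rewrite mulrDr E wX; ring.
  by move/eqP; rewrite mulf_eq0 eqz_nat gtn_eqF //= addr_eq0 => /eqP.
case: (place_w) => _ _ _ [t [t0 wt]].
have [p [c [c0 sp tE]]] := model_coord d0 mdl free t.
have p0 : p != 0 by apply: contraNneq t0 => p0; rewrite tE p0 rmorph0 mul0r.
have [ep0 [i [pi wp]] _] := val_infinity d0 cop val_w model_X0 model_Y0 j0 wXj wYj sp p0.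
have val_pole (g : {poly K}) : g != 0 -> evX g != 0 /\ exists x : nat, w (evX g) = x%:Z * w X.
  move=> g0; have [? ?] := val_evX_infinity d0 val_w model_X0 j0 wXj g0.
  by split=> //; exists (size g).-1.
have [ec0 [y wc]] := val_pole _ c0.
have [_ [x wpi]] := val_pole _ pi.
move: wt; rewrite tE (valuationM val_w) ?invr_eq0 // (valuationV val_w) // wp wc wpi wXj wYj.
move: (nat_of_ord i) => z H.
have {}H : (x%:Z * d%:Z + z%:Z * n%:Z - y%:Z * d%:Z) * j = 1.
  by rewrite -H; ring.
have : (j %| 1)%Z by apply/dvdzP; eexists; apply/esym; exact: H.
rewrite dvdz1 => j1; have -> : j = -1 by move: j1 j0; clear; lia.
by rewrite opprK !mulr1.
Qed.

Lemma vge0_X : ~~ (w X < 0) -> vge w 0 X.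
Proof. by rewrite -leNgt vge_neq0 ?model_X0. Qed.

Lemma finite_Y : ~~ (w X < 0) -> vge w 0 Y.
Proof.
move=> /vge0_X wX; have := vge_poly val_w f wX; rewrite evXE !vge_neq0 ?model_Y0 //.
  by rewrite -place_Y_pow; nia.
by rewrite (evX_neq0 crv) // monic_neq0.
Qed.

Section Center.
Variables (a b : K).
Hypotheses (b0 : b != 0) (bd : b ^+ d = f.[a]) (wXa : 0 < w (X - iota a)) (wYb : 0 < w (Y - iota b)).
Let Xa0 := model_X_neq mdl a.
Let wYb1 : vge w 1 (Y - iota b).
Proof. by rewrite vge_neq0 ?(model_Y_neq d1 dK cop mf sf mdl) -?gtz0_ge1. Qed.

(* [(Y^d - b^d) / (Y - b)] is a unit at [(a, b)], so [Y - b] is a multiple of [X - a] there. *)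
Lemma center_dvd p : evXY p != 0 -> exists j : int, w (evXY p) = j * w (X - iota a).
Proof.
have X0 : vge w 0 X := vge0_center val_w Xa0 wXa.
have Y0 : vge w 0 Y := vge0_Y val_w wYb1.
(* Induction on a bound for the value of p(X, Y): if p vanishes at (a, b), a factor X - a is split
   off up to a unit. *)
have [N wN] : exists N : nat, w (evXY p) < N%:Z by exists (absz (w (evXY p))).+1; lia.
elim: N p wN => [|N IHN] p wN ep0.
  by have := vge_evXY val_w p X0 Y0; rewrite vge_neq0 //; lia.
have [pab|pab] := eqVneq p.[b%:P].[a] 0; last first.
  by have [_ ->] := val_evXY_center val_w Xa0 wXa wYb1 pab; exists 0; rewrite mul0r.
have [q pE] := bipoly_taylor b p.
have /factor_theorem [q2 q2E] : root p.[b%:P] a by rewrite rootE pab.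
have /factor_theorem [h hE] : root (f - (b ^+ d)%:P) a by rewrite rootE hornerD hornerN hornerC bd subrr.
pose s : {poly {poly K}} := \sum_(i < d) 'X^(d.-1 - i) * (b%:P%:P) ^+ i.
have sE : s * ('X - b%:P%:P) = 'X^d - (b ^+ d)%:P%:P.
  by rewrite mulrC -subrXX !rmorphXn.
have sab : s.[b%:P].[a] != 0.
  rewrite (_ : s.[_].[_] = d%:R * b ^+ d.-1) ?mulf_neq0 ?expf_neq0 //.
  rewrite /s !horner_sum (eq_bigr (fun=> b ^+ d.-1)) ?sumr_const ?card_ord ?mulr_natl // => i _.
  rewrite hornerM hornerXn horner_exp hornerC hornerM !horner_exp hornerC -exprD subnK //.
  by move: (ltn_ord i); move: (nat_of_ord i) => j; clear; lia.
have [es0 ws] := val_evXY_center val_w Xa0 wXa wYb1 sab.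
(* Here p = q (y - b) + q2 (x - a), and on the curve s (y - b) = y^d - b^d = f - b^d = h (x - a). *)
have E : evXY s * evXY p = (X - iota a) * evXY (q * h%:P + s * q2%:P).
  have eX : evXY ('X - a%:P)%:P = X - iota a by rewrite evXYC rmorphB /= evX_X evXC.
  have eW : evXY ('X^d) = evXY f%:P.
    by apply/eqP; rewrite -subr_eq0 -rmorphB; apply/eqP; apply: evXY_curve_poly crv.
  have e1 : evXY (s * ('X - b%:P%:P)) = evXY (h * ('X - a%:P))%:P.
    by rewrite sE rmorphB /= eW -rmorphB -hE polyCB.
  transitivity (evXY (q * (s * ('X - b%:P%:P)) + s * (q2 * ('X - a%:P))%:P)).
    by rewrite {1}pE q2E -rmorphM; congr (evXY _); ring.
  rewrite rmorphD [evXY (q * _)]rmorphM e1 -eX -!rmorphM -rmorphD; congr (evXY _).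
  by rewrite !polyCM; ring.
have e'0 : evXY (q * h%:P + s * q2%:P) != 0.
  by apply: contraNneq (mulf_neq0 es0 ep0) => e'0; rewrite E e'0 mulr0.
have := congr1 w E; rewrite !(valuationM val_w) // ws add0r => wE.
have [|j wj] := IHN (q * h%:P + s * q2%:P) _ e'0; first by move: wN wXa; rewrite wE; move: (w _) (w _) => u v; clear; lia.
by exists (1 + j); rewrite wE wj; ring.
Qed.

(** All values are multiples of w(X - a) by [center_dvd], and 1 is among them. *)
Lemma place_center : w (X - iota a) = 1.
Proof.
case: (place_w) => _ _ _ [t [t0 wt]].
case: (mdl) => _ _ /(_ t) [p [q [q0 tE]]].
have p0 : evXY p != 0 by apply: contraNneq t0; rewrite tE ev2E => ->; rewrite mul0r.
have [i wp] := center_dvd p0; have [j wq] := center_dvd q0.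
move: wt; rewrite tE (valuationM val_w) ?invr_eq0 // (valuationV val_w) // wp wq.
move: (w _) wXa => c c0 H; have {}H : (i - j) * c = 1 by rewrite -H; ring.
have : (c %| 1)%Z by apply/dvdzP; eexists; apply/esym; exact: H.
by rewrite dvdz1; lia.
Qed.
End Center.
End Place.

(** * A function with divisor m(Q) - m(O) *)

Section NormPower.
Variables (K L : fieldType) (d n : nat) (f : {poly K}) (iota : {rmorphism K -> L}) (X Y : L).
Hypotheses (d1 : (1 < d)%N) (dK : (d%:R : K) != 0) (cop : coprime n d)
  (mf : f \is monic) (sf : size f = n.+1) (mdl : is_function_field_model d f iota X Y).
Variables (a b : K) (e : nat) (U V : {poly K}).
Let m := (n + e * d)%N.
Hypotheses (b0 : b != 0) (bd : b ^+ d = f.[a]) (sV : size V = e.+1) (Va : V.[a] != 0)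
  (UV : b * V.[a] = U.[a]) (sU : (d * (size U).-1 < m)%N)
  (normE : ('X - a%:P) ^+ m = V ^+ d * f - U ^+ d).
Local Notation evX := (evX iota X).
Local Notation evXY := (evXY iota X Y).
Let d0 := ltnW d1.
Let crv := model_on_curve mdl.

(** With G = V y - U and H the cofactor of G in (V y)^d - U^d, G H = (X - a)^m. At infinity V y
    dominates U; at affine points not above a, G and H are units; at Q, H is a unit and G takes the
    whole order m; at other points above a, G is a unit. *)
Lemma principal_norm_power : multiple_principal iota X Y a b m.
Proof.
pose pG : {poly {poly K}} := V%:P * 'X - U%:P.
pose pH : {poly {poly K}} := \sum_(i < d) (V%:P * 'X) ^+ (d.-1 - i) * U%:P ^+ i.
have V0 : V != 0 by rewrite -size_poly_eq0 sV.
have eX : evX ('X - a%:P) = X - iota a by rewrite rmorphB /= evX_X evXC.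
have GH : evXY pG * evXY pH = (X - iota a) ^+ m.
  rewrite -rmorphM -subrXX rmorphB /= exprMn !rmorphM /= -!rmorphXn /= !evXYC.
  have -> : evXY 'X^d = evX f by rewrite rmorphXn /= evXY_X (proj1 crv).
  by rewrite -rmorphM -rmorphB -normE rmorphXn /= eX.
have Xa0 := model_X_neq mdl a; have Yb0 := model_Y_neq d1 dK cop mf sf mdl b.
have /andP[G0 H0] : (evXY pG != 0) && (evXY pH != 0).
  by rewrite -negb_or -mulf_eq0 GH expf_neq0.
have X0 := model_X0 mdl; have Y0 := model_Y0 d1 dK cop mf sf mdl.
exists (evXY pG); split=> // w pl; have vw := place_valuation pl.
have wGH : w (evXY pG) + w (evXY pH) = m%:Z * w (X - iota a).
  by rewrite -(valuationM vw) // GH (valuationX vw).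
rewrite /place_at /place_at_infinity.
have [wX|wX] := boolP (w X < 0).
  have [wXd wYn] := place_infinity d1 dK cop mf sf mdl pl wX.
  have val_pole c : c != 0 -> evX c != 0 /\ w (evX c) = (size c).-1%:Z * w X.
    exact: (val_poly_pole vw).
  have [_] := val_pole _ (monic_neq0 (monicXsubC a)); rewrite size_XsubC eX mul1r => ->.
  rewrite ltNge (ltW wX) /= sub0r.
  have [VX0 wV] := val_pole _ V0.
  have VY0 : evX V * Y != 0 by rewrite mulf_neq0.
  have wVY : w (evX V * Y) = - m%:Z.
    by rewrite (valuationM vw) // wV sV wXd wYn /m PoszD PoszM; ring.
  rewrite rmorphB rmorphM /= !evXYC evXY_X.
  have [|_ ->] := @val_dominant _ _ _ _ vw (evX V * Y) (- evX U) VY0; last by [].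
  rewrite (vgeN vw) /vge; have [->|U0] := eqVneq U 0; first by rewrite rmorph0 eqxx.
  have [_ ->] := val_pole _ U0; rewrite wVY wXd mulrN -PoszM mulnC; apply/orP; right.
  by move: sU; rewrite -/m; move: m (d * _)%N => x y; clear; lia.
rewrite subr0; have vX := vge0_X mdl wX; have vY := finite_Y d1 dK cop mf sf mdl pl wX.
have vG := vge_evXY vw pG vX vY; have vH := vge_evXY vw pH vX vY.
rewrite !vge_neq0 // in vG vH.
have [wXa|wXa] := ltP 0 (w (X - iota a)); last first.
  have : vge w 0 (X - iota a) by apply: (vgeD vw) => //; rewrite (vgeN vw) (vgeC vw).
  rewrite vge_neq0 // => wXa'; have wXa0 : w (X - iota a) = 0 by apply/eqP; rewrite eq_le wXa.
  by move: wGH vG vH; rewrite wXa0 mulr0 /=; move: (w _) (w _) => x y; clear; lia.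
rewrite /=; have [wYb|wYb] := ltP 0 (w (Y - iota b)).
  have wYb1 : vge w 1 (Y - iota b) by rewrite vge_neq0 // -gtz0_ge1.
  (* At Q both V y and U equal b V(a), so each of the d summands of H is (b V(a))^(d-1). *)
  have Hab : pH.[b%:P].[a] != 0.
    rewrite (_ : pH.[_].[_] = d%:R * (b * V.[a]) ^+ d.-1) ?mulf_neq0 ?expf_neq0 ?mulf_neq0 //.
    rewrite /pH !horner_sum (eq_bigr (fun=> (b * V.[a]) ^+ d.-1)) ?sumr_const ?card_ord ?mulr_natl // => i _.
    rewrite !(hornerM, horner_exp, hornerX, hornerC) -UV [V.[a] * _]mulrC -exprD subnK //.
    by move: (ltn_ord i); move: (nat_of_ord i) => j; clear; lia.
  have [_ wH] := val_evXY_center vw Xa0 wXa wYb1 Hab.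
  by move: wGH; rewrite wH addr0 (place_center d1 dK cop mf sf mdl pl b0 bd wXa wYb) mulr1.
have [VX0 wV] : evX V != 0 /\ w (evX V) = 0 by apply: (val_poly_center vw Xa0 wXa).
have wYb0 : w (Y - iota b) = 0.
  have : vge w 0 (Y - iota b) by apply: (vgeD vw) => //; rewrite (vgeN vw) (vgeC vw).
  by rewrite vge_neq0 //; move: wYb; move: (w _) => x; clear; lia.
(* Above a but away from Q, the first summand is a unit and the second vanishes, because b V(a) =
   U(a). *)
have -> : evXY pG = (Y - iota b) * evX V + evX (b%:P * V - U).
  by rewrite /pG !rmorphB !rmorphM /= !evXYC evXY_X evXC; ring.
have YV0 : (Y - iota b) * evX V != 0 by rewrite mulf_neq0.
have wYV : w ((Y - iota b) * evX V) = 0 by rewrite (valuationM vw) // wYb0 wV.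
have [|_ ->] := @val_dominant _ _ _ _ vw _ (evX (b%:P * V - U)) YV0; last by [].
rewrite wYV add0r; have := vge_poly_center vw Xa0 wXa (b%:P * V - U).
by rewrite hornerD hornerN hornerM hornerC UV subrr rmorph0 subr0.
Qed.
End NormPower.

(** * Regular functions, and exclusion of multiples below n *)

(** Bezout applied to divisors: u k = v m + gcd(k, m) gives the function g^u / h^v. *)
Lemma multiple_principal_gcd (K L : fieldType) (iota : {rmorphism K -> L}) (X Y : L) a b k m :
  (0 < k)%N -> multiple_principal iota X Y a b k -> multiple_principal iota X Y a b m ->
  multiple_principal iota X Y a b (gcdn k m).
Proof.
move=> k0 [g [g0 gP]] [h [h0 hP]]; case: (egcdnP m k0) => u v E _.
exists (g ^+ u / h ^+ v); split; first by rewrite mulf_neq0 ?invr_eq0 ?expf_neq0.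
move=> w pl; have vw := place_valuation pl.
rewrite (valuationM vw) ?invr_eq0 ?expf_neq0 // (valuationV vw) ?expf_neq0 //.
rewrite !(valuationX vw) // gP // hP //; move: E.
by move: (w g) (w h); case: place_at; case: place_at_infinity; clear; nia.
Qed.

(** The polynomial q = x^d - v has d distinct roots, since x q' - d q = d v is a nonzero
    constant. *)
Lemma poly_eq0_on_roots (K : closedFieldType) (d : nat) (v : K) (p : {poly K}) :
  (d%:R : K) != 0 -> v != 0 -> (size p <= d)%N ->
  (forall b, b ^+ d = v -> p.[b] = 0) -> p = 0.
Proof.
move=> dK v0 sp pr; have d0 : (0 < d)%N by rewrite lt0n; apply: contraNneq dK => ->.
pose q : {poly K} := 'X^d - v%:P.
have sq : size q = d.+1 by rewrite size_XnsubC.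
have mq : q \is monic by rewrite monicXnsubC.
have [r qr] := closed_field_poly_normal q; rewrite (monicP mq) scale1r in qr.
have ur : uniq r.
  rewrite -separable_prod_XsubC -qr unlock; apply/Bezout_coprimepP.
  exists (- d%:R%:P, 'X); rewrite /= /q derivB derivXn derivC subr0.
  have -> : - d%:R%:P * ('X^d - v%:P) + 'X * ('X^(d.-1) *+ d) = (d%:R * v)%:P.
    rewrite mulrnAr -exprS prednK // -mulr_natl polyCM polyC_natr; ring.
  by rewrite polyC_eqp1 mulf_neq0.
have sr : size r = d.
  by apply/eqP; rewrite -eqSS -sq qr size_prod_XsubC.
apply: contraTeq sp => p0; rewrite -ltnNge -sr; apply: max_poly_roots => //.
apply/allP => b br; apply/eqP; apply: pr; apply/eqP; rewrite -subr_eq0.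
have : root q b by rewrite qr root_prod_XsubC.
by rewrite rootE /q hornerD hornerN hornerXn hornerC.
Qed.

Section Regular.
Variables (K : closedFieldType) (L : fieldType) (d n : nat) (f : {poly K})
  (iota : {rmorphism K -> L}) (X Y : L).
Hypotheses (d1 : (1 < d)%N) (dK : (d%:R : K) != 0) (cop : coprime n d)
  (mf : f \is monic) (sf : size f = n.+1) (nrr : no_repeated_roots f)
  (mdl : is_function_field_model d f iota X Y).
Let crv := model_on_curve mdl.
Let d0 := ltnW d1.
Let free := model_free d1 dK cop mf sf mdl.
Local Notation evX := (evX iota X).
Local Notation evXY := (evXY iota X Y).

(** Regularity on the affine curve: [vge w 0 X] singles out the places other than O. *)
Definition regular (g : L) : Prop :=
  forall w, is_place iota w -> vge w 0 X -> vge w 0 g.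

(** The numerator vanishes at all places above a. If f(a) is nonzero, p(a, y) has degree below d and
    vanishes at d points. If f(a) = 0, f has a simple root there and the place is totally ramified:
    each nonzero p_i y^i has value at least d, while y^i contributes only i < d, so p_i(a) = 0. *)
Lemma regular_coef_root (a : K) (p : {poly {poly K}}) (c : {poly K}) : c != 0 ->
  root c a -> (size p <= d)%N -> regular (evXY p / evX c) -> forall i, root p`_i a.
Proof.
move=> c0 ca sp reg i; have eX := model_X_neq mdl a.
have c1 : (0 < mup a c)%N.
  by rewrite mup_geq // expr1 dvdp_XsubCl.
have c0X : evX c != 0 := evX_neq0 crv c0.
have regw w : is_place iota w -> 0 < w (X - iota a) -> vge w (w (evX c)) (evXY p).
  move=> pl wX; have vw := place_valuation pl.
  have := reg w pl (vge0_center vw eX wX).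
  rewrite /vge mulf_eq0 invr_eq0 (negPf c0X) orbF; have [//|p0 /=] := eqVneq (evXY p) 0.
  by rewrite (valuationM vw) ?invr_eq0 // (valuationV vw) // subr_ge0.
have [fa|fa] := eqVneq f.[a] 0; last first.
  have : map_poly (horner_eval a) p = 0.
    apply: (poly_eq0_on_roots dK fa) => [|b bd]; first exact: leq_trans (size_poly _ _) sp.
    have b0 : b != 0.
      by apply: contraNneq fa => b0; rewrite -bd b0 expr0n gtn_eqF.
    have [w pl [wX wY]] := exists_place_unramified d1 dK cop mf sf mdl b0 bd.
    have vw := place_valuation pl; have wX0 : 0 < w (X - iota a) by rewrite wX.
    have wY1 : vge w 1 (Y - iota b).
      by rewrite vge_neq0 ?(model_Y_neq d1 dK cop mf sf mdl) // -gtz0_ge1.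
    have := regw w pl wX0; have [_ ->] := val_poly_root vw eX wX0 c0.
    rewrite wX mulr1 => /(vgeW (j := 1)); rewrite lez_nat => /(_ c1) wp.
    have := vge_evXY_center vw eX wX0 wY1 p; rewrite -(vgeN vw) opprB => wp'.
    have /eqP pab : p.[b%:P].[a] == 0.
      have := vgeD vw wp' wp; rewrite subrK /vge fmorph_eq0 => /orP[//|].
      by apply: contraTT => nz; rewrite (valuationC vw).
    by rewrite -[b](hornerC b a) -/(horner_eval a b%:P) horner_map.
  by move/polyP => /(_ i); rewrite coef_map coef0 => H; apply/eqP; exact: H.
have /factor_theorem [g fE] : root f a by apply/eqP.
have ga : g.[a] != 0.
  apply: contra (nrr a) => ga; have /factor_theorem [h hE] : root g a by [].
  by rewrite fE hE -mulrA -expr2 dvdp_mull.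
have [b bd] := exists_root g.[a] d0.
have b0 : b != 0 by apply: contraNneq ga => b0; rewrite -bd b0 expr0n gtn_eqF.
have [w pl [wX wY]] := exists_place_ramified d1 dK cop mf sf mdl fE b0 bd.
have vw := place_valuation pl; have wX0 : 0 < w (X - iota a) by rewrite wX ltz_nat.
have wE q : q != 0 -> evX q != 0 /\ w (evX q) = (mup a q)%:Z * d%:Z.
  by rewrite -wX; apply: (val_poly_root vw).
have [->|pi0] := eqVneq p`_i 0; first exact: root0.
have p0 : p != 0 by apply: contraNneq pi0 => ->; rewrite coef0.
have Y0 := model_Y0 d1 dK cop mf sf mdl.
have wY1 : w Y = 1 * 1 by rewrite wY.
have cop1 : coprimez 1 d by rewrite coprimezE /= coprime1n.
have wE1 q : q != 0 -> evX q != 0 /\ exists j : int, w (evX q) = j * d%:Z * 1.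
  by move=> q0; have [? ->] := wE q q0; split=> //; exists (mup a q)%:Z; rewrite mulr1.
have [ep0 _ /(_ i pi0)] := val_ramified d0 vw (oner_neq0 _) Y0 wY1 cop1 wE1 sp p0.
have := regw w pl wX0; rewrite vge_neq0 //.
have [_ ->] := wE _ c0; have [_ ->] := wE _ pi0; rewrite wY mulr1.
have id : (i < d)%N.
  by apply: leq_trans sp; rewrite ltnNge; apply: contraNN pi0 => /leq_sizeP ->.
move=> h1 h2; rewrite -dvdp_XsubCl -(expr1 ('X - _)) -mup_geq //.
move: (le_trans h1 h2); rewrite -PoszM -PoszM -PoszD lez_nat => h3.
rewrite lt0n; apply: contraTneq h3 => ->; rewrite mul0n add0n -ltnNge.
by apply: leq_trans id _; rewrite leq_pmull.
Qed.

(** Induction on the degree of the denominator: at a root a of c, [regular_coef_root] allows x - a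
    to be cancelled. *)
Lemma regular_poly (g : L) : regular g ->
  exists2 p : {poly {poly K}}, (size p <= d)%N & g = evXY p.
Proof.
have [p [c [c0 sp ->]]] := model_coord d0 mdl free g.
have [N sc] := ubnP (size c); elim: N p c c0 sp sc => // N IHN p c c0 sp sc reg.
have [sc1|sc1] := leqP (size c) 1.
  have cE := size1_polyC sc1; exists ((c`_0)^-1%:P *: p).
    by apply: leq_trans (size_scale_leq _ _) sp.
  by rewrite evXYZ {1}cE !evXC fmorphV mulrC.
have /closed_rootP [a ca] : size c != 1%N by rewrite gtn_eqF.
have pa := regular_coef_root c0 ca sp reg.
have /factor_theorem [c' cE] := ca.
pose p' : {poly {poly K}} := \poly_(i < size p) (p`_i %/ ('X - a%:P)).
have pE : p = ('X - a%:P) *: p'.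
  apply/polyP => i; rewrite coefZ coef_poly.
  have [_|le] := ltnP i (size p); last by rewrite mulr0; apply: (leq_sizeP _ _ (leqnn _)).
  by rewrite mulrC divpK // dvdp_XsubCl.
have c'0 : c' != 0 by apply: contraNneq c0 => c'0; rewrite cE c'0 mul0r.
have E : evXY p / evX c = evXY p' / evX c'.
  have X0 : evX ('X - a%:P) != 0 by rewrite (evX_neq0 crv) // monic_neq0 // monicXsubC.
  by rewrite {1}pE evXYZ cE rmorphM /= [evX c' * _]mulrC -mulf_div mulfV // mul1r.
rewrite E in reg *; apply: (IHN p' c') => //.
  exact: leq_trans (size_poly _ _) sp.
by move: sc; rewrite cE size_mul ?polyXsubC_eq0 // size_XsubC addn2 /=.
Qed.

Variables (a b : K).
Hypotheses (b0 : b != 0) (bd : b ^+ d = f.[a]).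

Lemma not_principal_lt (k : nat) : (0 < k < n)%N -> ~ multiple_principal iota X Y a b k.
Proof.
move=> /andP[k0 kn] [g [g0 gP]].
have X0 := model_X0 mdl; have Y0 := model_Y0 d1 dK cop mf sf mdl.
have [|p sp gE] := @regular_poly g.
  move=> w pl; rewrite !vge_neq0 // => wX; rewrite gP //.
  by rewrite /place_at_infinity ltNge wX subr0; case: place_at.
have p0 : p != 0 by apply: contraNneq g0 => p0; rewrite gE p0 rmorph0.
have [w pl wX] := exists_place_infinity d1 dK cop mf sf mdl.
have vw := place_valuation pl.
have [wXd wYn] := place_infinity d1 dK cop mf sf mdl pl wX.
have wX1 : w X = - (d%:Z * 1) by rewrite mulr1.
have wY1 : w Y = - (n%:Z * 1) by rewrite mulr1.
have wE := val_evX_infinity d0 vw X0 ltr01 wX1.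
have wg : w g = - k%:Z.
  rewrite gP // /place_at /place_at_infinity wX.
  have [_] := wE _ (monic_neq0 (monicXsubC a)).
  rewrite size_XsubC rmorphB /= evX_X evXC mul1r => ->.
  by rewrite ltNge (ltW wX) sub0r.
have [ep0 [i [pi0 wp]] ple] := val_infinity d0 cop vw X0 Y0 ltr01 wX1 wY1 sp p0.
(* A nonzero term p_j y^j with j > 0 would give g a pole of order at least n at O, but that order is
   k < n. *)
have coef0 j : (0 < j)%N -> p`_j = 0.
  move=> j0; apply/eqP; apply: contraT => pj0.
  have := ple j pj0; have [_ ->] := wE _ pj0; rewrite -gE wg wXd wYn.
  by move: ((size (p`_j)%R).-1) kn j0 => x; clear; nia.
have pE : p = (p`_0)%:P.
  by apply/size1_polyC/leq_sizeP => j; apply: coef0.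
have p00 : p`_0 != 0 by move: p0; rewrite {1}pE polyC_eq0.
have kE : k = ((size (p`_0)%R).-1 * d)%N.
  have [_] := wE _ p00; rewrite -(evXYC iota X Y) -pE -gE wg wXd.
  by rewrite mulrN -PoszM => /oppr_inj [].
(* At Q, where x - a is a uniformizer, p_0(x) vanishes to order k, so (x - a)^k divides p_0, whose
   degree is only k / d. *)
have [w' pl' [w'X w'Y]] := exists_place_unramified d1 dK cop mf sf mdl b0 bd.
have vw' := place_valuation pl'; have w'X0 : 0 < w' (X - iota a) by rewrite w'X.
have eX := model_X_neq mdl a.
have : w' g = k%:Z.
  rewrite gP // /place_at /place_at_infinity w'X0 w'Y /=.
  by have := vge0_center vw' eX w'X0; rewrite vge_neq0 // leNgt => /negPf ->; rewrite subr0.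
rewrite gE pE evXYC; have [_ ->] := val_poly_root vw' eX w'X0 p00.
rewrite w'X mulr1 => -[muE].
have : (('X - a%:P) ^+ k %| p`_0) by rewrite -mup_geq // muE.
move/(dvdp_leq p00); rewrite size_exp_XsubC.
by move: (size _) kE k0 d1 => x; clear; nia.
Qed.

End Regular.

(** * Proper divisors of m, and the conclusion *)

(** Let m = n + ed = q k with q > 1. If ed < n then k <= m/2 < n. Otherwise the inequality forces d
    = 2, then n odd gives n = 2e - 1, so m = 2n + 1 is odd, q >= 3 and k <= m/3 < n. *)
Lemma divisor_lt (d n e k : nat) : (1 < d)%N -> (d < n)%N -> coprime n d ->
  (e * d ^ 2 < n + (e + 1) * d)%N ->
  (k %| n + e * d)%N -> (k < n + e * d)%N -> (k < n)%N.
Proof.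
move=> d1 dn cop ineq /dvdnP [q mE] km.
have q2 : (1 < q)%N by case: q mE km => [|[|q]] //; clear; nia.
have [lt|ge] := ltnP (e * d) n; first by move: mE q2 lt; clear; nia.
have d2 : d = 2%N by move: ge ineq d1 dn; rewrite -mulnn; clear; nia.
have n2 : odd n by rewrite -coprimen2 -d2.
have nE : (n = 2 * e - 1)%N.
  by move: ge ineq n2 dn; rewrite d2; clear; lia.
have q3 : (2 < q)%N by move: q2 mE nE dn; rewrite d2; case: q {km} => [|[|[|q]]] //; clear; lia.
by move: mE nE dn q3; rewrite d2; clear; nia.
Qed.

Unset Implicit Arguments.

Theorem mainTheorem5 (K : closedFieldType) (charK0 : [pchar K] =i pred0)
  (d n e : nat) (hd : (1 < d)%N) (hdn : (d < n)%N) (hcop : coprime n d)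
  (he : (0 < e)%N)
  (hineq : (e * d ^ 2)%:Z - ((e + 1) * d)%:Z < n%:Z) :
  reachable K n d (n + e * d).
Proof.
have ineq : (e * d ^ 2 < n + (e + 1) * d)%N by lia.
have dK : (d%:R : K) != 0 by move/pcharf0P: charK0 => ->; rewrite -lt0n ltnW.
split; first by move: hdn hd; clear; lia.
have [|f [U [b [mf sf nrr [b0 bd bU sU normE]]]]] := exists_curve charK0 hd hcop he.
  by move: ineq hdn; rewrite -mulnn -subn1 mulnBr muln1; clear; nia.
(* The point is Q = (-1, b); [principal_norm_power] is used with a = -1 and V = t^e. *)
exists f; split=> //; exists (-1), b; split=> // L iota X Y mdl.
have pm : multiple_principal iota X Y (-1) b (n + e * d).
  apply: (@principal_norm_power _ _ _ _ f _ _ _ hd dK hcop mf sf mdl _ _ e U 'X^e) => //.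
  - by rewrite size_polyXn.
  - by rewrite hornerXn expf_neq0 // oppr_eq0 oner_neq0.
  - by rewrite hornerXn.
  - by rewrite polyCN opprK.
split=> //; first by move: hdn; clear; lia.
move=> k /andP[k0 km] pk.
(* Passing to gcd(k, m) gives a proper divisor of m, hence a multiple below n by [divisor_lt]. *)
have := multiple_principal_gcd k0 pk pm.
apply: (not_principal_lt hd dK hcop mf sf nrr mdl b0 bd).
rewrite gcdn_gt0 k0 /=; apply: (divisor_lt hd hdn hcop ineq (dvdn_gcdr _ _)).
by apply: leq_ltn_trans km; apply: dvdn_leq => //; apply: dvdn_gcdl.
Qed.
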